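(* There exists a finite set $\Sigma$ of dependencies that is both guarded and sticky such that repair checking for $\Sigma$ (deciding, given databases $\mathcal{D}$ and $\mathcal{D}'$, whether $\mathcal{D}'$ is a repair of $\langle\Sigma,\mathcal{D}\rangle$) is coNP-hard with respect to data complexity.
   Context: A signature is a set of predicate symbols with arities, always containing a special 0-ary predicate $\bot$. A term is a constant or a variable; a (predicate) atom is $p(t_1,\dots,t_n)$; an inequality is $t\neq t'$. A database is a finite set of ground atoms (facts) not containing $\bot$. A conjunction with inequalities is a conjunction of at least one predicate atom or inequality. A CQ is $\exists\vec y\,\gamma$ with $\gamma$ a conjunction with inequalities; a UCQ is a finite disjunction of CQs. A dependency is a first-order sentence $\forall\vec x\,(\gamma\rightarrow Q)$ where $\gamma$ (the body) is a conjunction with inequalities whose variables are in $\vec x$, each occurring in some predicate atom of $\gamma$, and $Q$ (the head) is a UCQ whose free variables are among $\vec x$ and in which every existentially quantified variable of each disjunct occurs in a predicate atom of that disjunct. $\mathcal{D}$ is consistent with a finite set $\Sigma$ of dependencies if $\mathcal{D}$ satisfies every dependency of $\Sigma$. A repair of $\langle\Sigma,\mathcal{D}\rangle$ is an inclusion-maximal subset of $\mathcal{D}$ consistent with $\Sigma$. Data complexity: $\Sigma$ fixed, databases are the input. A dependency is guarded if some atom of its body contains all variables of the body. Stickiness: assume distinct dependencies use distinct variables; a variable $x$ in the body of $\tau\in\Sigma$ is marked if (i) some atom of the head of $\tau$ does not contain $x$, or (ii) there are $\tau'\in\Sigma$ and a predicate $p$ such that the head of $\tau$ contains $p(\vec t)$,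 the body of $\tau'$ contains $p(\vec t')$, and whenever $x$ is the $i$-th term of $\vec t$ the $i$-th term of $\vec t'$ is a marked variable (inductive definition). $\Sigma$ is sticky if, for every $\tau\in\Sigma$, every marked variable occurs at most once in the body of $\tau$. *)

(* Defs.v *)
From Stdlib Require Import List Arith PArith NArith.
Import ListNotations.

Inductive term := TConst (c : nat) | TVar (x : nat).

Inductive psym := PBot | PName (n : nat).

Inductive literal :=
| LAtom (p : psym) (ts : list term)
| LNeq (t1 t2 : term).

(* a conjunction with inequalities (non-emptiness imposed by well-formedness) *)
Definition conjunction := list literal.

(* CQ  exists (cq_ex) . cq_body *)
Record cq := { cq_ex : list nat; cq_body : conjunction }.

Definition ucq := list cq.

(* dependency  forall x . body -> head, x = the variables of the body *)
Record dependency := { dep_body : conjunction; dep_head : ucq }.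

(* a signature: named predicates with their arities; bottom (arity 0) is
   always implicitly present *)
Record signature := { sig_preds : list (nat * nat) }.

Definition sig_wf (sg : signature) : Prop := NoDup (map fst (sig_preds sg)).

Definition psym_ok (sg : signature) (p : psym) (ar : nat) : Prop :=
  match p with
  | PBot => ar = 0
  | PName n => In (n, ar) (sig_preds sg)
  end.

Definition term_vars (t : term) : list nat :=
  match t with TConst _ => [] | TVar x => [x] end.

Definition terms_vars (ts : list term) : list nat := flat_map term_vars ts.

Definition lit_vars (l : literal) : list nat :=
  match l with
  | LAtom _ ts => terms_vars ts
  | LNeq t1 t2 => term_vars t1 ++ term_vars t2
  end.

Definition conj_vars (c : conjunction) : list nat := flat_map lit_vars c.

Definition wf_conj (sg : signature) (c : conjunction) : Prop :=
  c <> [] /\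
  forall p ts, In (LAtom p ts) c -> psym_ok sg p (length ts).

Definition in_some_atom (c : conjunction) (x : nat) : Prop :=
  exists p ts, In (LAtom p ts) c /\ In x (terms_vars ts).

Definition wf_cq (sg : signature) (q : cq) : Prop :=
  wf_conj sg (cq_body q) /\
  forall y, In y (cq_ex q) -> in_some_atom (cq_body q) y.

Definition wf_dep (sg : signature) (d : dependency) : Prop :=
  wf_conj sg (dep_body d) /\
  (forall x, In x (conj_vars (dep_body d)) -> in_some_atom (dep_body d) x) /\
  dep_head d <> [] /\
  (forall q, In q (dep_head d) ->
     wf_cq sg q /\
     forall x, In x (conj_vars (cq_body q)) -> ~ In x (cq_ex q) ->
               In x (conj_vars (dep_body d))).

(* a fact p(c1,...,cn) with p a named predicate (databases never contain
   bottom); a database is a finite set of facts, represented by a list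
   (only membership matters) *)
Definition fact := (nat * list nat)%type.
Definition database := list fact.

Definition db_over (sg : signature) (D : database) : Prop :=
  forall n cs, In (n, cs) D -> In (n, length cs) (sig_preds sg).

Definition eval_term (h : nat -> nat) (t : term) : nat :=
  match t with TConst c => c | TVar x => h x end.

Definition lit_holds (D : database) (h : nat -> nat) (l : literal) : Prop :=
  match l with
  | LAtom PBot _ => False
  | LAtom (PName n) ts => In (n, map (eval_term h) ts) D
  | LNeq t1 t2 => eval_term h t1 <> eval_term h t2
  end.

Definition conj_holds (D : database) (h : nat -> nat) (c : conjunction) : Prop :=
  forall l, In l c -> lit_holds D h l.

Definition cq_holds (D : database) (h : nat -> nat) (q : cq) : Prop :=
  exists h' : nat -> nat,
    (forall x, ~ In x (cq_ex q) -> h' x = h x) /\ conj_holds D h' (cq_body q).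

Definition satisfies (D : database) (d : dependency) : Prop :=
  forall h : nat -> nat, conj_holds D h (dep_body d) ->
    exists q, In q (dep_head d) /\ cq_holds D h q.

Definition consistent (S : list dependency) (D : database) : Prop :=
  forall d, In d S -> satisfies D d.

Definition db_sub (D1 D2 : database) : Prop := forall f, In f D1 -> In f D2.

Definition is_repair (S : list dependency) (D D' : database) : Prop :=
  db_sub D' D /\ consistent S D' /\
  forall D'', db_sub D' D'' -> db_sub D'' D -> consistent S D'' -> db_sub D'' D'.

Definition guarded (d : dependency) : Prop :=
  exists p ts, In (LAtom p ts) (dep_body d) /\
    forall x, In x (conj_vars (dep_body d)) -> In x (terms_vars ts).

Definition head_lits (d : dependency) : list literal := flat_map cq_body (dep_head d).

Definition dep_all_vars (d : dependency) : list nat :=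
  conj_vars (dep_body d) ++
  flat_map (fun q => cq_ex q ++ conj_vars (cq_body q)) (dep_head d).

Definition distinct_vars (S : list dependency) : Prop :=
  forall i j, i < length S -> j < length S -> i <> j ->
    forall x, In x (dep_all_vars (nth i S {| dep_body := []; dep_head := [] |})) ->
              ~ In x (dep_all_vars (nth j S {| dep_body := []; dep_head := [] |})).

Inductive marked (S : list dependency) : dependency -> nat -> Prop :=
| mark_i : forall d x,
    In d S -> In x (conj_vars (dep_body d)) ->
    (exists p ts, In (LAtom p ts) (head_lits d) /\ ~ In x (terms_vars ts)) ->
    marked S d x
| mark_ii : forall d x d' p ts ts',
    In d S -> In d' S -> In x (conj_vars (dep_body d)) ->
    In (LAtom p ts) (head_lits d) -> In (LAtom p ts') (dep_body d') ->
    (forall i, i < length ts -> nth i ts (TConst 0) = TVar x ->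
       exists y, nth i ts' (TConst 0) = TVar y /\ marked S d' y) ->
    marked S d x.

Definition sticky (S : list dependency) : Prop :=
  distinct_vars S /\
  forall d x, In d S -> marked S d x ->
    count_occ Nat.eq_dec (conj_vars (dep_body d)) x <= 1.

Fixpoint pos_bits (p : positive) : list bool :=
  match p with
  | xH => [true]
  | xO p' => false :: pos_bits p'
  | xI p' => true :: pos_bits p'
  end.

Definition nat_bits (n : nat) : list bool :=
  match N.of_nat n with N0 => [] | Npos p => pos_bits p end.

Definition tok_digit (b : bool) : list bool := [false; false; b].
Definition tok_endnum : list bool := [false; true; false].
Definition tok_endfact : list bool := [false; true; true].
Definition tok_enddb : list bool := [true; false; false].

Definition enc_nat (n : nat) : list bool :=
  flat_map tok_digit (nat_bits n) ++ tok_endnum.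

Definition enc_fact (f : fact) : list bool :=
  enc_nat (fst f) ++ flat_map enc_nat (snd f) ++ tok_endfact.

Definition enc_db (D : database) : list bool := flat_map enc_fact D ++ tok_enddb.

Definition enc_pair (D D' : database) : list bool := enc_db D ++ enc_db D'.

Definition language := list bool -> Prop.

(* repair checking for S (data complexity: S and the signature are fixed,
   the input is a pair of databases over the signature) *)
Definition repair_checking (sg : signature) (S : list dependency) : language :=
  fun w => exists D D', db_over sg D /\ db_over sg D' /\
                        w = enc_pair D D' /\ is_repair S D D'.

Inductive move := MLeft | MRight | MStay.

(* single-tape Turing machine (possibly nondeterministic) with a finite
   transition list (state, read, new state, write, move).  Tape symbol 0 is
   the blank, 1 and 2 encode the input bits false and true. *)
Record TM := {
  tm_start : nat;
  tm_final : nat;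
  tm_trans : list (nat * nat * nat * nat * move)
}.

(* state, left part (nearest cell first), right part (head cell first);
   the tape is blank outside the lists *)
Definition config := (nat * list nat * list nat)%type.

Definition apply_move (l r : list nat) (b : nat) (m : move) : list nat * list nat :=
  match m with
  | MStay => (l, b :: tl r)
  | MRight => (b :: l, tl r)
  | MLeft => (tl l, hd 0 l :: b :: tl r)
  end.

Definition step (M : TM) (c c' : config) : Prop :=
  let '(q, l, r) := c in
  let '(q', l', r') := c' in
  exists b m, In (q, hd 0 r, q', b, m) (tm_trans M) /\ (l', r') = apply_move l r b m.

Fixpoint steps (M : TM) (n : nat) (c c' : config) : Prop :=
  match n with
  | 0 => c = c'
  | S n' => exists c'', step M c c'' /\ steps M n' c'' c'
  end.

Definition bit_sym (b : bool) : nat := if b then 2 else 1.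

Definition init_config (M : TM) (w : list bool) : config :=
  (tm_start M, [], map bit_sym w).

Definition poly_bound (c k n : nat) : nat := c * n ^ k + c.

Definition in_NP (L : language) : Prop :=
  exists (M : TM) (c k : nat), forall w,
    L w <-> exists n l r, n <= poly_bound c k (length w) /\
                          steps M n (init_config M w) (tm_final M, l, r).

Definition in_coNP (L : language) : Prop :=
  exists L', in_NP L' /\ forall w, L w <-> ~ L' w.

Definition deterministic (M : TM) : Prop :=
  (forall q a q1 b1 m1 q2 b2 m2,
     In (q, a, q1, b1, m1) (tm_trans M) -> In (q, a, q2, b2, m2) (tm_trans M) ->
     q1 = q2 /\ b1 = b2 /\ m1 = m2) /\
  (forall a q' b m, ~ In (tm_final M, a, q', b, m) (tm_trans M)).

(* f is computable in polynomial time by a deterministic TM: the output is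
   the maximal block of bit symbols starting at the head when halting *)
Definition poly_time_computable (f : list bool -> list bool) : Prop :=
  exists (M : TM) (c k : nat), deterministic M /\ forall w,
    exists n l r', n <= poly_bound c k (length w) /\
      steps M n (init_config M w) (tm_final M, l, map bit_sym (f w) ++ r') /\
      (forall a r'', r' = a :: r'' -> a <> 1 /\ a <> 2).

Definition poly_reduces (A B : language) : Prop :=
  exists f, poly_time_computable f /\ forall w, A w <-> B (f w).

Definition coNP_hard (B : language) : Prop :=
  forall A, in_coNP A -> poly_reduces A B.

(* Main.v *)
From Stdlib Require Import Arith NArith Lia Bool.
Require Import Defs.
From Stdlib Require Import List.
Import ListNotations.

(* Let L' be accepted by a nondeterministic machine M in time T, a
   polynomial of the length of the input w. The runs of M on w are the tilings of a
   grid of T + 2 rows by Wang tiles. The databases contain the facts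
   [slot(t,i)], one per cell of the grid, and [conf(t,i,x,t',i',y)], one per pair of
   tiles x, y that do not match at adjacent cells; D has in addition the fact [go]
   and a fact [item(t,i,x)] per tile x admissible at (t,i). The dependencies say that
   under [go] every slot has an item, that an item needs [go], and that conflicting
   items exclude each other. So D' is not maximal iff one can add [go] and thus a
   whole tiling, i.e. iff w is in L'. Position j is named by the constant 2^j, whose
   binary code is j zeros followed by a one.
   The reduction is a composition of passes, i.e. of at most two nested loops over the
   positions of the current string that append to the next one. They are written in
   a while language over tapes, and compiled to a deterministic machine. *)

(** * A while language compiled to Turing machines *)

(** Guardedness and stickiness come from moving the work from the dependencies into the data.
    Adjacency of cells and incompatibility of tiles are not derived by joins: each forbidden pair is
    one [conf] fact, and its six arguments guard the body of the exclusion rule. That body repeats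
    variables, so none of them may be marked. With the atom [PBot] in the head, clause (i) would
    mark them all; falsity is therefore written as the inequality of 0 with itself, and a head
    without atoms marks nothing. The fact [go] makes non-maximality all or nothing: one item forces
    [go], and [go] forces an item into every slot, so every consistent proper extension of the slots
    and conflicts inside D contains a whole tiling. The other obstacle is to exhibit a concrete
    deterministic one-tape machine. Rows and columns of the grid are therefore positions of one and
    the same string, whose letters tell the role of a position; a fact then depends only on two
    positions and their letters. Time bounds are kept as crude polynomials in the length of the
    tape. *)

Inductive kind := KBit (b : bool) | KX | KZ | KM | KL | KE.

(** One mark per nesting level: the outer loop, the inner loop, and the loop that counts the cells
    in front of one of these two marks. *)
Inductive mark := MRow | MCol | MPre.

Inductive sym :=
| Blank
| Cell (k : kind) (row col pre : bool)
| Sep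
| Bar.

Definition kinds : list kind := [KBit false; KBit true; KX; KZ; KM; KL; KE].

(** The order fixes the codes: the blank and the two unmarked bits come first and get 0, 1, 2, as
    the machine model prescribes. *)
Definition all_syms : list sym :=
  Blank :: map (fun k => Cell k false false false) kinds ++
  flat_map (fun k => map (fun '(a, b, c) => Cell k a b c)
    [(false,false,true); (false,true,false); (false,true,true); (true,false,false);
     (true,false,true); (true,true,false); (true,true,true)]) kinds ++ [Sep; Bar].

Definition kind_eq_dec (x y : kind) : {x = y} + {x <> y}.
Proof. decide equality; apply bool_dec. Defined.

Definition sym_eq_dec (x y : sym) : {x = y} + {x <> y}.
Proof. decide equality; try apply bool_dec; apply kind_eq_dec. Defined.

Fixpoint index_of (s : sym) (xs : list sym) : nat :=
  match xs with
  | [] => 0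
  | x :: xs' => if sym_eq_dec s x then 0 else S (index_of s xs')
  end.

Definition code (s : sym) : nat := index_of s all_syms.

Lemma in_all_syms (s : sym) : In s all_syms.
Proof.
  destruct s as [|[[]| | | | |] [] [] []| |]; cbn; tauto.
Qed.

Lemma nth_index_of (s : sym) (xs : list sym) :
  In s xs -> nth (index_of s xs) xs Blank = s.
Proof.
  induction xs as [|x xs IH]; cbn; [tauto|].
  destruct (sym_eq_dec s x); intuition congruence.
Qed.

Lemma code_inj (s s' : sym) : code s = code s' -> s = s'.
Proof.
  unfold code; intros H.
  rewrite <- (nth_index_of s all_syms), <- (nth_index_of s' all_syms), H; auto using in_all_syms.
Qed.

Definition plain (k : kind) : sym := Cell k false false false.

Lemma code_bit (b : bool) : code (plain (KBit b)) = bit_sym b.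
Proof. destruct b; reflexivity. Qed.

Lemma code_blank : code Blank = 0.
Proof. reflexivity. Qed.

Global Opaque all_syms code.

Definition tape := (list sym * list sym)%type.

Definition scan (t : tape) : sym := hd Blank (snd t).

Definition act (t : tape) (s : sym) (m : move) : tape :=
  let '(l, r) := t in
  match m with
  | MStay => (l, s :: tl r)
  | MRight => (s :: l, tl r)
  | MLeft => (tl l, hd Blank l :: s :: tl r)
  end.

Inductive prog :=
| Act (f : sym -> sym * move)
| Seq (p q : prog)
| If (b : sym -> bool) (p q : prog)
| While (b : sym -> bool) (p : prog).

(** By [ev_weaken] the number is only an upper bound on the running time, so that costs can be
    rounded up at every level. *)
Inductive ev : prog -> nat -> tape -> tape -> Prop :=
| ev_act f t : ev (Act f) 1 t (act t (fst (f (scan t))) (snd (f (scan t))))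
| ev_seq p q n m t1 t2 t3 : ev p n t1 t2 -> ev q m t2 t3 -> ev (Seq p q) (n + m) t1 t3
| ev_if_true b p q n t t' : b (scan t) = true -> ev p n t t' -> ev (If b p q) (S n) t t'
| ev_if_false b p q n t t' : b (scan t) = false -> ev q n t t' -> ev (If b p q) (S n) t t'
| ev_while_end b p t : b (scan t) = false -> ev (While b p) 1 t t
| ev_while_loop b p n m t1 t2 t3 : b (scan t1) = true -> ev p n t1 t2 ->
    ev (While b p) m t2 t3 -> ev (While b p) (S (n + m)) t1 t3
| ev_weaken p n m t t' : ev p n t t' -> n <= m -> ev p m t t'.

Fixpoint size (p : prog) : nat :=
  match p with
  | Act _ => 1
  | Seq p q => size p + size q
  | If _ p q => 1 + size p + size q
  | While _ p => 1 + size p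
  end.

Definition delta := nat -> sym -> nat * sym * move.

(* [p] occupies the states [i, ..., i + size p - 1], is entered in state [i]
   and left by moving to state [e]; outside that range the value is junk. *)
Fixpoint trans_of (p : prog) (i e : nat) : delta := fun q a =>
  match p with
  | Act f => (e, fst (f a), snd (f a))
  | Seq p1 p2 =>
      if q <? i + size p1 then trans_of p1 i (i + size p1) q a
      else trans_of p2 (i + size p1) e q a
  | If b p1 p2 =>
      if q <? S i then (if b a then S i else S i + size p1, a, MStay)
      else if q <? S i + size p1 then trans_of p1 (S i) e q a
      else trans_of p2 (S i + size p1) e q a
  | While b p1 =>
      if q <? S i then (if b a then S i else e, a, MStay)
      else trans_of p1 (S i) i q a
  end.

Definition dstep (d : delta) (c : nat * tape) : nat * tape :=
  let '(q, t) := c in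
  let '(q', s, m) := d q (scan t) in (q', act t s m).

(** The bound [hi] records that every step leaves a state below [hi]; for a whole program these are
    the states with transitions in [machine]. *)
Inductive dsteps (d : delta) (hi : nat) : nat -> nat * tape -> nat * tape -> Prop :=
| dsteps_refl c : dsteps d hi 0 c c
| dsteps_step n q t c : q < hi -> dsteps d hi n (dstep d (q, t)) c -> dsteps d hi (S n) (q, t) c.

Lemma dsteps_trans d hi n m c1 c2 c3 :
  dsteps d hi n c1 c2 -> dsteps d hi m c2 c3 -> dsteps d hi (n + m) c1 c3.
Proof. induction 1; cbn; auto. intros; constructor; auto. Qed.

Definition agrees (d : delta) (p : prog) (i e : nat) : Prop :=
  forall q a, i <= q < i + size p -> d q a = trans_of p i e q a.

(* Moving without writing turns an exhausted right part [[]] into [[Blank]], so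
   tapes are compared up to trailing blanks. *)
Definition same_tape (t t' : tape) : Prop :=
  forall n, nth n (fst t) Blank = nth n (fst t') Blank /\
            nth n (snd t) Blank = nth n (snd t') Blank.

Lemma same_tape_scan t t' : same_tape t t' -> scan t = scan t'.
Proof.
  intros H; specialize (H 0); destruct t as [l [|x r]], t' as [l' [|x' r']]; apply H.
Qed.

Lemma nth_tl {X} (d : X) n xs : nth n (tl xs) d = nth (S n) xs d.
Proof. destruct xs; cbn; auto. now destruct n. Qed.

Lemma hd_nth {X} (d : X) xs : hd d xs = nth 0 xs d.
Proof. now destruct xs. Qed.

Lemma same_tape_act t t' s m : same_tape t t' -> same_tape (act t s m) (act t' s m).
Proof.
  destruct t as [l r], t' as [l' r']; intros H n; cbn in H.
  destruct m; cbn; rewrite ?nth_tl, ?hd_nth.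
  - split; [apply H|]. destruct n as [|[|n]]; auto; [apply (H 0)|].
    rewrite !nth_tl; apply H.
  - split; [|apply H]. destruct n; auto; apply H.
  - split; [apply H|]. destruct n; auto; rewrite !nth_tl; apply H.
Qed.

Lemma same_tape_stay t t' : same_tape t t' -> same_tape (act t (scan t) MStay) t'.
Proof.
  destruct t as [l r]; intros H n; cbn. split; [apply H|].
  rewrite <- (proj2 (H n)). destruct r, n as [|[|n]]; auto.
Qed.

(** Induction on the run rather than on the program: the remaining rounds of a loop are then covered
    by the hypothesis for the same block of states. A test is one step that writes the scanned
    symbol back, so the tapes agree only up to [same_tape]. *)
Lemma ev_compiled p n t1 t2 :
  ev p n t1 t2 ->
  forall d hi i e t1', agrees d p i e -> i + size p <= hi -> same_tape t1' t1 ->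
  exists m t2', m <= n /\ dsteps d hi m (i, t1') (e, t2') /\ same_tape t2' t2.
Proof.
  induction 1 as [f t|p q n m t1 t2 t3 _ IH1 _ IH2|b p q n t t' Hb _ IH|b p q n t t' Hb _ IH
    |b p t Hb|b p n m t1 t2 t3 Hb _ IH1 _ IH2|p n m t t' _ IH Hnm];
    intros d hi i e t1' A Hi E; cbn in Hi.
  - exists 1; eexists; split; [lia|]. split; [|now apply same_tape_act, E].
    constructor; [lia|]. cbn. rewrite A by (cbn; lia); cbn.
    rewrite (same_tape_scan _ _ E); constructor.
  - destruct (IH1 d hi i (i + size p) t1') as (m1 & t2' & L1 & S1 & E1); auto; [|lia|].
    { intros s a Hs; rewrite A by (cbn; lia); cbn -[Nat.ltb].
      destruct (Nat.ltb_spec s (i + size p)); auto; lia. }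
    destruct (IH2 d hi (i + size p) e t2') as (m2 & t3' & L2 & S2 & E2); auto; [|lia|].
    { intros s a Hs; rewrite A by (cbn; lia); cbn -[Nat.ltb].
      destruct (Nat.ltb_spec s (i + size p)); auto; lia. }
    exists (m1 + m2), t3'; repeat split; try apply E2; [lia|]. eauto using dsteps_trans.
  - destruct (IH d hi (S i) e (act t1' (scan t1') MStay)) as (m & t2' & L & S1 & E1);
      auto using same_tape_stay; [|lia|].
    { intros s a Hs; rewrite A by (cbn; lia); cbn -[Nat.ltb Nat.leb].
      destruct (Nat.ltb_spec s (S i)), (Nat.ltb_spec s (S (i + size p))); auto; lia. }
    exists (S m), t2'; repeat split; try apply E1; [lia|].
    constructor; [lia|]. cbn. rewrite A by (cbn; lia); cbn -[Nat.ltb Nat.leb].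
    destruct (Nat.ltb_spec i (S i)); [|lia]. now rewrite (same_tape_scan _ _ E) in *; rewrite Hb.
  - destruct (IH d hi (S (i + size p)) e (act t1' (scan t1') MStay)) as (m & t2' & L & S1 & E1);
      auto using same_tape_stay; [|lia|].
    { intros s a Hs; rewrite A by (cbn; lia); cbn -[Nat.ltb Nat.leb].
      destruct (Nat.ltb_spec s (S i)), (Nat.ltb_spec s (S (i + size p))); auto; lia. }
    exists (S m), t2'; repeat split; try apply E1; [lia|].
    constructor; [lia|]. cbn. rewrite A by (cbn; lia); cbn -[Nat.ltb Nat.leb].
    destruct (Nat.ltb_spec i (S i)); [|lia]. now rewrite (same_tape_scan _ _ E) in *; rewrite Hb.
  - exists 1; eexists; split; [lia|]. split; [|apply same_tape_stay, E].
    constructor; [lia|]. cbn. rewrite A by (cbn; lia); cbn -[Nat.ltb Nat.leb].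
    destruct (Nat.ltb_spec i (S i)); [|lia]. rewrite (same_tape_scan _ _ E), Hb; constructor.
  - destruct (IH1 d hi (S i) i (act t1' (scan t1') MStay)) as (m1 & t2' & L1 & S1 & E1);
      auto using same_tape_stay; [|lia|].
    { intros s a Hs; rewrite A by (cbn; lia); cbn -[Nat.ltb Nat.leb].
      destruct (Nat.ltb_spec s (S i)); auto; lia. }
    destruct (IH2 d hi i e t2') as (m2 & t3' & L2 & S2 & E2); auto.
    exists (S (m1 + m2)), t3'; repeat split; try apply E2; [lia|].
    constructor; [lia|]. eapply dsteps_trans; eauto.
    cbn. rewrite A by (cbn; lia); cbn -[Nat.ltb Nat.leb].
    destruct (Nat.ltb_spec i (S i)); [|lia]. now rewrite (same_tape_scan _ _ E) in *; rewrite Hb.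
  - destruct (IH d hi i e t1') as (k & t2' & L & S1 & E1); auto.
    exists k, t2'; repeat split; try apply E1; auto; lia.
Qed.

(** * Programs as deterministic machines of the given model *)

Definition machine (p : prog) : TM := {|
  tm_start := 0;
  tm_final := size p;
  tm_trans := flat_map (fun q => map (fun a =>
      let '(q', b, m) := trans_of p 0 (size p) q a in (q, code a, q', code b, m)) all_syms)
    (seq 0 (size p)) |}.

Lemma in_machine p q a q' b m :
  In (q, a, q', b, m) (tm_trans (machine p)) <->
  q < size p /\ exists s s', a = code s /\ b = code s' /\ trans_of p 0 (size p) q s = (q', s', m).
Proof.
  cbn. rewrite in_flat_map. split.
  - intros (q0 & Hq & H). apply in_map_iff in H as (s & H & _). apply in_seq in Hq.
    destruct (trans_of p 0 (size p) q0 s) as [[q1 s'] m'] eqn:T.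
    inversion H; subst. split; [lia|eauto].
  - intros (Hq & s & s' & -> & -> & T). exists q; split; [apply in_seq; lia|].
    apply in_map_iff. exists s; split; auto using in_all_syms. now rewrite T.
Qed.

Lemma machine_deterministic p : deterministic (machine p).
Proof.
  split.
  - intros * H1 H2. apply in_machine in H1 as (_ & s1 & s1' & E1 & -> & T1).
    apply in_machine in H2 as (_ & s2 & s2' & E2 & -> & T2).
    assert (s1 = s2) by (apply code_inj; congruence); subst.
    rewrite T1 in T2; inversion T2; auto.
  - intros * H. apply in_machine in H as [H _]. cbn in H; lia.
Qed.

Definition cfg_of (q : nat) (t : tape) : config := (q, map code (fst t), map code (snd t)).

Lemma hd_map_code r : hd 0 (map code r) = code (hd Blank r).
Proof. destruct r; cbn; auto using code_blank. Qed.

Lemma machine_steps p n q t q' t' :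
  dsteps (trans_of p 0 (size p)) (size p) n (q, t) (q', t') ->
  steps (machine p) n (cfg_of q t) (cfg_of q' t').
Proof.
  remember (q, t) as c; remember (q', t') as c'; intros H; revert q t Heqc.
  induction H as [c|n q1 t1 c Hq _ IH]; intros q t E; subst.
  - inversion E; reflexivity.
  - inversion E; subst; clear E. cbn in IH |- *.
    destruct (trans_of p 0 (size p) q (scan t)) as [[q1 s] m] eqn:T.
    exists (cfg_of q1 (act t s m)); split; auto.
    cbn. exists (code s), m; split.
    + apply in_machine; split; auto. exists (scan t), s. rewrite hd_map_code; auto.
    + destruct t as [l [|x r]], m, l; cbn; rewrite ?code_blank; reflexivity.
Qed.

(** The output convention forbids a bit right after the output block; a tape known up to trailing
    blanks has only blanks there. *)
Lemma nth_blank_split xs r :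
  (forall n, nth n r Blank = nth n (map plain xs) Blank) ->
  exists r', r = map plain xs ++ r' /\ forall s, In s r' -> s = Blank.
Proof.
  revert r; induction xs as [|x xs IH]; intros r H.
  - exists r; split; auto. intros s Hs. apply (In_nth _ _ Blank) in Hs as (n & _ & <-).
    rewrite H; now destruct n.
  - destruct r as [|y r]; [discriminate (H 0)|].
    destruct (IH r) as (r' & -> & B); [exact (fun n => H (S n))|].
    exists r'; split; auto. cbn; f_equal. exact (H 0).
Qed.

Lemma machine_computes p w bs n g :
  ev p n ([], map (fun b => plain (KBit b)) w) (g, map (fun b => plain (KBit b)) bs) ->
  exists m l r', m <= n /\
    steps (machine p) m (init_config (machine p) w)
      (tm_final (machine p), l, map bit_sym bs ++ r') /\
    (forall a r'', r' = a :: r'' -> a <> 1 /\ a <> 2).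
Proof.
  intros H. destruct (ev_compiled _ _ _ _ H (trans_of p 0 (size p)) (size p) 0 (size p)
    ([], map (fun b => plain (KBit b)) w)) as (m & [l r] & L & S & E); try easy.
  destruct (nth_blank_split (map KBit bs) r) as (r' & -> & B).
  { intros k; rewrite map_map; apply E. }
  apply machine_steps in S. exists m, (map code l), (map code r'); repeat split; auto.
  - replace (init_config _ _) with (cfg_of 0 ([], map (fun b => plain (KBit b)) w)).
    + unfold cfg_of in S at 2; cbn [fst snd] in S. rewrite map_app, !map_map in S.
      rewrite (map_ext _ _ code_bit) in S. exact S.
    + unfold cfg_of, init_config; cbn [fst snd map]. rewrite map_map.
      now rewrite (map_ext _ _ code_bit).
  - destruct r' as [|s r']; inversion H0. now rewrite (B s), code_blank by now left.
  - destruct r' as [|s r']; inversion H0. now rewrite (B s), code_blank by now left.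
Qed.

(** * Loops over the cells of the tape *)

Definition is_blank (s : sym) : bool := match s with Blank => true | _ => false end.
Definition is_sep (s : sym) : bool := match s with Sep => true | _ => false end.
Definition is_bar (s : sym) : bool := match s with Bar => true | _ => false end.
Definition is_cell (s : sym) : bool := match s with Cell _ _ _ _ => true | _ => false end.

Definition kind_of (s : sym) : kind := match s with Cell k _ _ _ => k | _ => KX end.

Definition has_mark (m : mark) (s : sym) : bool :=
  match s, m with
  | Cell _ a _ _, MRow => a
  | Cell _ _ b _, MCol => b
  | Cell _ _ _ c, MPre => c
  | _, _ => false
  end.

Definition set_mark (m : mark) (v : bool) (s : sym) : sym :=
  match s, m with
  | Cell k a b c, MRow => Cell k v b c
  | Cell k a b c, MCol => Cell k a v c
  | Cell k a b c, MPre => Cell k a b v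
  | _, _ => s
  end.

Definition skip : prog := Act (fun s => (s, MStay)).
Definition right : prog := Act (fun s => (s, MRight)).
Definition left : prog := Act (fun s => (s, MLeft)).
Definition seek (b : sym -> bool) (p : prog) : prog := While (fun s => negb (b s)) p.
Definition go_home : prog := seek is_sep left.

Definition append (k : kind) : prog :=
  Seq (seek is_blank right) (Seq (Act (fun _ => (plain k, MStay))) go_home).

(** The choice of the branch remembers the kind under the head, which can therefore return to [Sep]
    before the body runs. *)
Definition dispatch (body : kind -> prog) : prog :=
  fold_right (fun k p => If (fun s => if kind_eq_dec (kind_of s) k then true else false)
                            (Seq go_home (body k)) p) skip kinds.

(** The mark lets the loop find its cell again, since the body starts and ends at [Sep]. *)
Definition for_cells (m : mark) (stop : sym -> bool) (body : kind -> prog) : prog :=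
  Seq right
    (Seq (seek stop
           (Seq (Act (fun s => (set_mark m true s, MStay)))
             (Seq (dispatch body)
               (Seq (seek (has_mark m) right)
                    (Act (fun s => (set_mark m false s, MRight)))))))
         go_home).

Definition seqs (ps : list prog) : prog := fold_right Seq skip ps.

(* The work tape between two passes: the current input [cs 0, ..., cs (N - 1)]
   lies between [Sep], where the head rests, and [Bar]; the output [o] follows. *)
Definition home (g : list sym) (N : nat) (cs : nat -> sym) (o : list kind) : tape :=
  (g, Sep :: map cs (seq 0 N) ++ Bar :: map plain o).

Lemma home_ext g N cs cs' o :
  (forall j, j < N -> cs j = cs' j) -> home g N cs o = home g N cs' o.
Proof.
  intros H; unfold home. rewrite (map_ext_in cs cs'); auto.
  intros j Hj; apply in_seq in Hj; apply H; lia.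
Qed.

Lemma ev_act' f t t' :
  act t (fst (f (scan t))) (snd (f (scan t))) = t' -> ev (Act f) 1 t t'.
Proof. intros <-; constructor. Qed.

Lemma seek_right b xs l r :
  (forall s, In s xs -> b s = false) -> b (hd Blank r) = true ->
  ev (seek b right) (2 * length xs + 1) (l, xs ++ r) (rev xs ++ l, r).
Proof.
  revert l; induction xs as [|x xs IH]; intros l H Hr.
  - apply ev_while_end. unfold scan; cbn [snd app]. now rewrite Hr.
  - replace (2 * length (x :: xs) + 1) with (S (1 + (2 * length xs + 1))) by (cbn; lia).
    eapply ev_while_loop.
    + cbn. now rewrite H by now left.
    + apply ev_act'; reflexivity.
    + cbn. rewrite <- app_assoc. apply IH; auto. intros s Hs; apply H; now right.
Qed.

Lemma go_home_spec xs g y r :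
  (forall s, In s xs -> is_sep s = false) -> is_sep y = false ->
  ev go_home (2 * length xs + 3) (rev xs ++ Sep :: g, y :: r) (g, Sep :: xs ++ y :: r).
Proof.
  revert y r; induction xs as [|x xs IH] using rev_ind; intros y r H Hy.
  - apply (ev_while_loop _ _ 1 1 _ (g, Sep :: y :: r)).
    + cbn. now rewrite Hy.
    + apply ev_act'; reflexivity.
    + apply ev_while_end. reflexivity.
  - rewrite length_app; cbn [length].
    replace (2 * (length xs + 1) + 3) with (S (1 + (2 * length xs + 3))) by lia.
    eapply ev_while_loop.
    + cbn. now rewrite Hy.
    + apply ev_act'; reflexivity.
    + rewrite rev_app_distr; cbn. rewrite <- app_assoc. apply IH.
      * intros s Hs; apply H, in_or_app; auto.
      * apply H, in_or_app; cbn; auto.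
Qed.

Lemma not_sep_cells N cs o s :
  (forall j, j < N -> is_cell (cs j) = true) ->
  In s (map cs (seq 0 N) ++ Bar :: map plain o) -> is_sep s = false /\ is_blank s = false.
Proof.
  intros H Hs. apply in_app_or in Hs as [Hs|[<-|Hs]]; auto.
  - apply in_map_iff in Hs as (j & <- & Hj). apply in_seq in Hj.
    specialize (H j ltac:(lia)). destruct (cs j); auto.
  - apply in_map_iff in Hs as (k & <- & _); auto.
Qed.

Lemma append_spec g N cs o k :
  (forall j, j < N -> is_cell (cs j) = true) ->
  ev (append k) (4 * (N + length o) + 11) (home g N cs o) (home g N cs (o ++ [k])).
Proof.
  intros H. set (xs := map cs (seq 0 N) ++ Bar :: map plain o).
  assert (L : length xs = N + S (length o)).
  { unfold xs. rewrite length_app; cbn. now rewrite !length_map, length_seq. }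
  apply ev_weaken with (2 * length (Sep :: xs) + 1 + (1 + (2 * length xs + 3)));
    [|cbn [length]; lia].
  eapply ev_seq; [|eapply ev_seq].
  - replace (home g N cs o) with (g, (Sep :: xs) ++ []) by (now rewrite app_nil_r).
    apply seek_right; auto.
    intros s [<-|Hs]; auto. eapply not_sep_cells; eauto.
  - apply ev_act'; reflexivity.
  - replace (home g N cs (o ++ [k])) with (g, Sep :: xs ++ [plain k]).
    + cbn [rev]. rewrite <- app_assoc. apply go_home_spec; auto.
      intros s Hs; eapply not_sep_cells; eauto.
    + unfold home, xs. rewrite map_app, <- app_assoc. reflexivity.
Qed.

Lemma skip_spec g N cs o : ev skip 1 (home g N cs o) (home g N cs o).
Proof. apply ev_act'; reflexivity. Qed.

Lemma dispatch_spec body t t1 t2 n m :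
  ev go_home n t t1 -> ev (body (kind_of (scan t))) m t1 t2 ->
  ev (dispatch body) (n + m + 8) t t2.
Proof.
  intros H1 H2. pose proof (ev_seq _ _ _ _ _ _ _ H1 H2) as H.
  unfold dispatch, kinds; cbn [fold_right].
  destruct (kind_of (scan t)) as [[]| | | | |] eqn:E;
    (eapply ev_weaken;
     [repeat first [eapply ev_if_true; [now rewrite E|exact H]
                   |eapply ev_if_false; [now rewrite E|]]|lia]).
Qed.

Definition update (cs : nat -> sym) (j : nat) (s : sym) : nat -> sym :=
  fun x => if x =? j then s else cs x.

Lemma seq_split j N : j < N -> seq 0 N = seq 0 j ++ j :: seq (S j) (N - S j).
Proof.
  intros H. replace N with (j + S (N - S j)) at 1 by lia. now rewrite seq_app.
Qed.

Lemma map_update cs j s N :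
  j < N -> map (update cs j s) (seq 0 N) = map cs (seq 0 j) ++ s :: map cs (seq (S j) (N - S j)).
Proof.
  intros H. rewrite (seq_split j N H), map_app; cbn [map]. unfold update at 2.
  rewrite Nat.eqb_refl. f_equal; [|f_equal]; apply map_ext_in; intros x Hx; apply in_seq in Hx;
    unfold update; destruct (Nat.eqb_spec x j); auto; lia.
Qed.

Lemma has_set_mark m v s : is_cell s = true -> has_mark m (set_mark m v s) = v.
Proof. now destruct s, m. Qed.

Lemma kind_set_mark m v s : kind_of (set_mark m v s) = kind_of s.
Proof. now destruct s, m. Qed.

Lemma unset_set_mark m s : has_mark m s = false -> set_mark m false (set_mark m true s) = s.
Proof. destruct s, m; cbn; congruence. Qed.

Section ForCells.

Variables (m : mark) (stop : sym -> bool) (body : kind -> prog).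
(** The loop stops at cell [K], or at [Bar] if [K = N]. The cap [O] on the final output length
    allows one time bound [B] for all rounds although the output grows. *)
Variables (g : list sym) (N K : nat) (cs : nat -> sym) (out : nat -> list kind) (B O : nat).
Hypothesis (HK : K <= N) (Hcell : forall j, j < N -> is_cell (cs j) = true).
Hypothesis (Hmark : forall j, j < K -> has_mark m (cs j) = false).
Hypothesis (Hgo : forall j, j < K -> stop (cs j) = false).
Hypothesis (Hstop : K < N -> stop (cs K) = true) (Hbar : stop Bar = true).
Hypothesis Hbody : forall j o, j < K -> length o + length (out j) <= O ->
  ev (body (kind_of (cs j))) B (home g N (update cs j (set_mark m true (cs j))) o)
     (home g N (update cs j (set_mark m true (cs j))) (o ++ out j)).

Definition at_cell (j : nat) (o : list kind) : tape :=
  (rev (map cs (seq 0 j)) ++ Sep :: g, map cs (seq j (N - j)) ++ Bar :: map plain o).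

Lemma loop_body_spec j o :
  j < K -> length o + length (out j) <= O ->
  ev (Seq (Act (fun s => (set_mark m true s, MStay)))
       (Seq (dispatch body)
         (Seq (seek (has_mark m) right)
              (Act (fun s => (set_mark m false s, MRight))))))
     (B + 4 * N + 16) (at_cell j o) (at_cell (S j) (o ++ out j)).
Proof.
  intros Hj Ho. set (c := set_mark m true (cs j)).
  set (rest := fun o => map cs (seq (S j) (N - S j)) ++ Bar :: map plain o).
  assert (Hpre : forall s, In s (map cs (seq 0 j)) -> is_sep s = false /\ has_mark m s = false).
  { intros s Hs. apply in_map_iff in Hs as (x & <- & Hx). apply in_seq in Hx.
    rewrite Hmark by lia. specialize (Hcell x ltac:(lia)). destruct (cs x); auto. }
  assert (Hh : forall o',
    home g N (update cs j c) o' = (g, Sep :: map cs (seq 0 j) ++ c :: rest o')).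
  { intros o'. unfold home, rest. rewrite map_update by lia. now rewrite <- app_assoc. }
  apply ev_weaken with
    (1 + ((2 * length (map cs (seq 0 j)) + 3 + B + 8)
       + ((2 * length (Sep :: map cs (seq 0 j)) + 1) + 1)));
    [|cbn [length]; rewrite length_map, length_seq; lia].
  eapply ev_seq; [|eapply ev_seq; [|eapply ev_seq]].
  - apply ev_act'. unfold at_cell. replace (N - j) with (S (N - S j)) by lia.
    cbn [seq map app]. unfold scan; cbn [fst snd hd act tl]. reflexivity.
  - eapply dispatch_spec.
    + apply go_home_spec; [intros; now apply Hpre|].
      unfold c. specialize (Hcell j ltac:(lia)). destruct (cs j), m; easy.
    + unfold scan; cbn [snd hd]. rewrite kind_set_mark.
      pose proof (Hbody j o Hj Ho) as H. fold c in H |- *.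
      rewrite !Hh in H. exact H.
  - change (Sep :: map cs (seq 0 j) ++ c :: rest (o ++ out j))
      with ((Sep :: map cs (seq 0 j)) ++ c :: rest (o ++ out j)).
    apply seek_right; [|apply has_set_mark, Hcell; lia].
    intros s [<-|Hs]; [now destruct m|now apply Hpre].
  - apply ev_act'. unfold scan; cbn [snd hd fst act tl]. unfold at_cell, c, rest.
    rewrite unset_set_mark by auto. rewrite seq_S, (map_app cs), rev_app_distr.
    cbn. now rewrite <- app_assoc.
Qed.

Lemma loop_spec k j o :
  j + k = K -> length o + length (flat_map out (seq j k)) <= O ->
  ev (seek stop
       (Seq (Act (fun s => (set_mark m true s, MStay)))
         (Seq (dispatch body)
           (Seq (seek (has_mark m) right)
                (Act (fun s => (set_mark m false s, MRight)))))))
     (k * (B + 4 * N + 17) + 1) (at_cell j o) (at_cell K (o ++ flat_map out (seq j k))).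
Proof.
  revert j o; induction k as [|k IH]; intros j o E Ho.
  - replace K with j by lia. cbn; rewrite app_nil_r. apply ev_while_end.
    unfold at_cell, scan; cbn [snd]. destruct (Nat.eq_dec K N) as [E'|E'].
    + replace (N - j) with 0 by lia. cbn. now rewrite Hbar.
    + replace (N - j) with (S (N - S j)) by lia. cbn. replace j with K by lia.
      rewrite Hstop by lia; auto.
  - cbn in Ho |- *. rewrite length_app in Ho.
    replace (B + (N + (N + (N + (N + 0)))) + 17 + k * (B + (N + (N + (N + (N + 0)))) + 17) + 1)
      with (S ((B + 4 * N + 16) + (k * (B + 4 * N + 17) + 1))) by lia.
    eapply ev_while_loop.
    + unfold at_cell, scan; cbn [snd]. replace (N - j) with (S (N - S j)) by lia.
      cbn. rewrite Hgo by lia; auto.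
    + apply loop_body_spec; lia.
    + rewrite app_assoc. apply IH; [lia|]. rewrite length_app; lia.
Qed.

Lemma for_cells_spec o :
  length o + length (flat_map out (seq 0 K)) <= O ->
  ev (for_cells m stop body) (S N * (B + 4 * N + 20))
     (home g N cs o) (home g N cs (o ++ flat_map out (seq 0 K))).
Proof.
  intros Ho.
  apply ev_weaken with (1 + ((K * (B + 4 * N + 17) + 1) + (2 * length (map cs (seq 0 K)) + 3)));
    [|rewrite length_map, length_seq; nia].
  eapply ev_seq; [|eapply ev_seq].
  - apply (ev_act' _ _ (at_cell 0 o)). unfold at_cell. rewrite Nat.sub_0_r. reflexivity.
  - apply loop_spec; auto.
  - set (o' := o ++ _).
    assert (E : exists y r, map cs (seq K (N - K)) ++ Bar :: map plain o' = y :: r /\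
      is_sep y = false).
    { destruct (Nat.eq_dec K N) as [E|E].
      - replace (N - K) with 0 by lia. cbn; eauto.
      - replace (N - K) with (S (N - S K)) by lia. cbn. do 2 eexists; split; [reflexivity|].
        specialize (Hcell K ltac:(lia)). now destruct (cs K). }
    destruct E as (y & r & E & Hy). unfold at_cell, home. rewrite E.
    replace (Sep :: map cs (seq 0 N) ++ Bar :: map plain o')
      with (Sep :: map cs (seq 0 K) ++ y :: r).
    + apply go_home_spec; auto. intros s Hs. apply in_map_iff in Hs as (x & <- & Hx).
      apply in_seq in Hx. specialize (Hcell x ltac:(lia)). now destruct (cs x).
    + rewrite <- E, app_assoc, <- map_app, <- seq_app. repeat f_equal; lia.
Qed.

End ForCells.

(** * String transformations defined by nested loops *)

(** Writing a loop position in unary is the only arithmetic that printing a [name] requires. *)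
Inductive piece := PSym (k : kind) | PRow (k : kind) | PCol (k : kind).

Inductive pass :=
| PLit (ks : list kind)
| PSingle (f : kind -> list kind)
| PDouble (f : kind -> kind -> list piece).

Definition piece_out (t i : nat) (p : piece) : list kind :=
  match p with
  | PSym k => [k]
  | PRow k => repeat k t
  | PCol k => repeat k i
  end.

Definition at_pos (rho : list kind) (j : nat) : kind := nth j rho KX.

Definition pass_out (rho : list kind) (p : pass) : list kind :=
  match p with
  | PLit ks => ks
  | PSingle f => flat_map (fun j => f (at_pos rho j)) (seq 0 (length rho))
  | PDouble f =>
      flat_map (fun t => flat_map (fun i =>
        flat_map (piece_out t i) (f (at_pos rho t) (at_pos rho i)))
        (seq 0 (length rho))) (seq 0 (length rho))
  end.

Definition stage_out (ps : list pass) (rho : list kind) : list kind :=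
  flat_map (pass_out rho) ps.

Definition piece_prog (p : piece) : prog :=
  match p with
  | PSym k => append k
  | PRow k => for_cells MPre (fun s => has_mark MRow s || is_bar s) (fun _ => append k)
  | PCol k => for_cells MPre (fun s => has_mark MCol s || is_bar s) (fun _ => append k)
  end.

Definition pass_prog (p : pass) : prog :=
  match p with
  | PLit ks => seqs (map append ks)
  | PSingle f => for_cells MCol is_bar (fun k => seqs (map append (f k)))
  | PDouble f => for_cells MRow is_bar (fun a =>
      for_cells MCol is_bar (fun b => seqs (map piece_prog (f a b))))
  end.

(* A position [length rho] stands for an absent mark. *)
Definition marked_cells (rho : list kind) (t i p : nat) : nat -> sym :=
  fun j => Cell (at_pos rho j) (j =? t) (j =? i) (j =? p).

Lemma seqs_spec {A} (pr : A -> prog) (out : A -> list kind) g N cs O B ps o :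
  (forall p o, In p ps -> length o + length (out p) <= O ->
     ev (pr p) B (home g N cs o) (home g N cs (o ++ out p))) ->
  length o + length (flat_map out ps) <= O ->
  ev (seqs (map pr ps)) (length ps * B + 1) (home g N cs o) (home g N cs (o ++ flat_map out ps)).
Proof.
  revert o; induction ps as [|p ps IH]; intros o H Ho.
  - cbn. rewrite app_nil_r. apply skip_spec.
  - cbn in Ho |- *. rewrite length_app in Ho. rewrite app_assoc, <- Nat.add_assoc.
    eapply ev_seq; [apply H; cbn; auto; lia|].
    apply IH; [intros; apply H; cbn; auto|rewrite length_app; lia].
Qed.

(** A unary piece is a loop of appends and takes at most [(N + 1) * (8 * N + 4 * O + 31)] steps,
    which the bound rounds up. *)
Lemma piece_spec g rho t i p O o :
  t < length rho -> i < length rho ->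
  length o + length (piece_out t i p) <= O ->
  ev (piece_prog p) (35 * (length rho + O + 1) ^ 2)
     (home g (length rho) (marked_cells rho t i (length rho)) o)
     (home g (length rho) (marked_cells rho t i (length rho)) (o ++ piece_out t i p)).
Proof.
  intros Ht Hi Ho. set (N := length rho) in *.
  assert (R : forall (k : kind) n, repeat k n = flat_map (fun _ => [k]) (seq 0 n)).
  { intros k n. generalize 0. induction n; intros; cbn; f_equal; auto. }
  destruct p as [k|k|k]; cbn [piece_prog piece_out length] in *.
  - eapply ev_weaken; [apply append_spec; reflexivity|cbn; nia].
  - rewrite R in Ho |- *. eapply ev_weaken;
      [apply for_cells_spec with (B := 4 * (N + O) + 11) (O := O); cbn; auto|cbn; nia].
    + lia.
    + intros j Hj. apply Nat.eqb_neq; lia.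
    + intros j Hj. rewrite orb_false_r. apply Nat.eqb_neq; lia.
    + rewrite Nat.eqb_refl; auto.
    + intros j o' Hj Ho'. eapply ev_weaken; [apply append_spec|lia].
      intros j' _. unfold update. now destruct (j' =? j).
  - rewrite R in Ho |- *. eapply ev_weaken;
      [apply for_cells_spec with (B := 4 * (N + O) + 11) (O := O); cbn; auto|cbn; nia].
    + lia.
    + intros j Hj. apply Nat.eqb_neq; lia.
    + intros j Hj. rewrite orb_false_r. apply Nat.eqb_neq; lia.
    + rewrite Nat.eqb_refl; auto.
    + intros j o' Hj Ho'. eapply ev_weaken; [apply append_spec|lia].
      intros j' _. unfold update. now destruct (j' =? j).
Qed.

(** Finiteness of the alphabet bounds the number of pieces written per cell by a constant of the
    pass, independent of the input. *)
Lemma kinds_bound (f : kind -> nat) : exists c, forall k, f k <= c.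
Proof.
  exists (list_sum (map f kinds)). intros [[]| | | | |]; cbn; lia.
Qed.

Lemma kinds_bound2 (f : kind -> kind -> nat) : exists c, forall a b, f a b <= c.
Proof.
  destruct (kinds_bound (fun a => list_sum (map (f a) kinds))) as [c H].
  exists c. intros a b. specialize (H a). destruct b as [[]| | | | |]; cbn in H; lia.
Qed.

Lemma length_flat_map_le {A B} (f : A -> list B) c xs :
  (forall x, In x xs -> length (f x) <= c) -> length (flat_map f xs) <= length xs * c.
Proof.
  induction xs as [|x xs IH]; cbn; intros H; auto. rewrite length_app.
  specialize (H x (or_introl eq_refl)) as H1. specialize (IH (fun y Hy => H y (or_intror Hy))). lia.
Qed.

Definition no_marks (rho : list kind) : nat -> sym :=
  marked_cells rho (length rho) (length rho) (length rho).

Lemma append_pass_spec g N cs O B ks o :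
  (forall j, j < N -> is_cell (cs j) = true) -> 4 * (N + O) + 11 <= B ->
  length o + length ks <= O ->
  ev (seqs (map append ks)) (length ks * B + 1) (home g N cs o) (home g N cs (o ++ ks)).
Proof.
  intros H HB Ho.
  assert (E : flat_map (fun k => [k]) ks = ks) by (clear; induction ks; cbn; congruence).
  rewrite <- E at 3. apply seqs_spec with (O := O); [|now rewrite E].
  intros k o' _ Ho'; cbn in Ho'. eapply ev_weaken; [now apply append_spec|lia].
Qed.

(** [W] bounds input and final output together. A piece costs a square of [W] and each of the two
    nested loops contributes one more factor, whence the fourth power. *)
Lemma pass_spec p : exists c, forall g rho o W,
  length rho + length (o ++ pass_out rho p) < W ->
  ev (pass_prog p) (c * W ^ 4) (home g (length rho) (no_marks rho) o)
     (home g (length rho) (no_marks rho) (o ++ pass_out rho p)).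
Proof.
  destruct p as [ks|f|f].
  - exists (11 * length ks + 1). intros g rho o W HW; cbn [pass_out pass_prog] in *.
    rewrite length_app in HW.
    (* [O] is the room that [W] leaves beside the input: [N + O = W - 1], so [4 * (N + O) + 11] is
       at most [11 * W]. *)
    eapply ev_weaken; [apply append_pass_spec with (O := W - 1 - length rho) (B := 11 * W)|];
      try reflexivity; try lia.
    assert (W <= W ^ 4) by (rewrite <- (Nat.pow_1_r W) at 1; apply Nat.pow_le_mono_r; lia).
    nia.
  - destruct (kinds_bound (fun k => length (f k))) as [P HP].
    exists (11 * P + 25). intros g rho o W HW; cbn [pass_out pass_prog] in *.
    rewrite length_app in HW.
    eapply ev_weaken;
      [apply for_cells_spec with (B := P * (11 * W) + 1) (O := W - 1 - length rho);
       try reflexivity; try lia|].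
    + intros j Hj. apply Nat.eqb_neq; lia.
    + intros j o' Hj Ho'. eapply ev_weaken;
        [apply append_pass_spec with (O := W - 1 - length rho) (B := 11 * W); try lia|].
      * intros x Hx. unfold update. destruct (x =? j); auto.
      * cbn. specialize (HP (at_pos rho j)). nia.
    + assert (W * W <= W ^ 4)
        by (replace (W * W) with (W ^ 2) by (cbn; lia); apply Nat.pow_le_mono_r; lia).
      nia.
  - destruct (kinds_bound2 (fun a b => length (f a b))) as [P HP].
    exists (35 * P + 60). intros g rho o W HW; cbn [pass_out pass_prog] in *.
    rewrite length_app in HW. set (N := length rho) in *.
    assert (HW0 : 0 < W) by lia. set (O := W - 1 - N).
    assert (H3 : W <= W ^ 3) by (rewrite <- (Nat.pow_1_r W) at 1; apply Nat.pow_le_mono_r; lia).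
    assert (H2 : W * W <= W ^ 3)
      by (replace (W * W) with (W ^ 2) by (cbn; lia); apply Nat.pow_le_mono_r; lia).
    eapply ev_weaken;
      [apply for_cells_spec with (B := (35 * P + 25) * W ^ 3) (O := O);
       try reflexivity; try lia|].
    + intros j Hj. apply Nat.eqb_neq; lia.
    + intros t o' Ht Ho'. cbn [kind_of no_marks marked_cells].
      set (cs := update _ _ _).
      assert (E : forall o, home g N cs o = home g N (marked_cells rho t N N) o).
      { intros o''. apply home_ext. intros j Hj. unfold cs, update, no_marks, marked_cells; fold N.
        destruct (Nat.eqb_spec j t); subst; cbn; f_equal; rewrite ?Nat.eqb_refl; auto;
          apply Nat.eqb_neq; lia. }
      rewrite !E.
      eapply ev_weaken;
        [apply for_cells_spec with (B := P * (35 * W ^ 2) + 1) (O := O);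
         try reflexivity; try lia|].
      * intros j Hj. apply Nat.eqb_neq; lia.
      * intros i o'' Hi Ho''. cbn [kind_of marked_cells].
        set (cs' := update _ _ _).
        assert (E' : forall o, home g N cs' o = home g N (marked_cells rho t i N) o).
        { intros o3. apply home_ext. intros j Hj. unfold cs', update, marked_cells; fold N.
          destruct (Nat.eqb_spec j i); subst; cbn; f_equal; rewrite ?Nat.eqb_refl; auto;
            apply Nat.eqb_neq; lia. }
        rewrite !E'.
        eapply ev_weaken; [apply seqs_spec with (B := 35 * W ^ 2) (O := O); auto|].
        -- intros p o3 _ Ho3. replace W with (N + O + 1) by lia. now apply piece_spec.
        -- specialize (HP (at_pos rho t) (at_pos rho i)). nia.
      * cbn [Nat.pow] in *. fold N. nia.
    + change (W ^ 4) with (W * W ^ 3). fold N. nia.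
Qed.

Lemma seqs_passes_spec ps : exists c, forall g rho o W,
  length rho + length (o ++ flat_map (pass_out rho) ps) < W ->
  ev (seqs (map pass_prog ps)) (c * W ^ 4) (home g (length rho) (no_marks rho) o)
     (home g (length rho) (no_marks rho) (o ++ flat_map (pass_out rho) ps)).
Proof.
  induction ps as [|p ps [c IH]].
  - exists 1. intros g rho o W HW. cbn [flat_map]. rewrite app_nil_r.
    eapply ev_weaken; [apply skip_spec|].
    assert (1 ^ 4 <= W ^ 4) by (apply Nat.pow_le_mono_l; lia). cbn in *; lia.
  - destruct (pass_spec p) as [c' Hp]. exists (c' + c). intros g rho o W HW.
    cbn [flat_map map seqs fold_right] in *. rewrite app_assoc in HW |- *.
    rewrite Nat.mul_add_distr_r. eapply ev_seq; [apply Hp|apply IH; auto].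
    rewrite length_app in HW. lia.
Qed.

(** Two loop indices, and unary pieces no longer than the string: the growth is at most cubic. *)
Lemma stage_out_length ps : exists c, forall rho,
  length (stage_out ps rho) <= c * (length rho + 1) ^ 3.
Proof.
  induction ps as [|p ps [c IH]]; [exists 0; cbn; lia|].
  assert (H : exists c, forall rho, length (pass_out rho p) <= c * (length rho + 1) ^ 3).
  { destruct p as [ks|f|f]; cbn [pass_out].
    - exists (length ks). intros rho. cbn. nia.
    - destruct (kinds_bound (fun k => length (f k))) as [P HP]. exists P. intros rho.
      etransitivity; [apply length_flat_map_le; auto|]. rewrite length_seq. cbn. nia.
    - destruct (kinds_bound2 (fun a b => length (f a b))) as [P HP]. exists P. intros rho.
      etransitivity; [apply length_flat_map_le with (c := length rho * (P * (length rho + 1)))|].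
      + intros t Ht; apply in_seq in Ht.
        etransitivity; [apply length_flat_map_le with (c := P * (length rho + 1))|].
        * intros i Hi; apply in_seq in Hi.
          etransitivity; [apply length_flat_map_le with (c := length rho + 1)|].
          -- intros q _. destruct q; cbn; rewrite ?repeat_length; lia.
          -- apply Nat.mul_le_mono_r; auto.
        * now rewrite length_seq.
      + rewrite length_seq. cbn. nia. }
  destruct H as [c' H]. exists (c' + c). intros rho. cbn. rewrite length_app.
  specialize (H rho); specialize (IH rho); unfold stage_out in IH. cbn in *. nia.
Qed.

(** The final step turns [Bar] into the next [Sep]: the old input stays on the left as garbage, and
    the output becomes the next input without being copied. *)
Definition stage_prog (ps : list pass) : prog :=
  Seq (Seq (seek is_blank right) (Seq (Act (fun _ => (Bar, MStay))) go_home))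
    (Seq (seqs (map pass_prog ps))
      (Seq (seek is_bar right) (Act (fun _ => (Sep, MRight))))).

Lemma map_nth_seq {A B} (f : A -> B) d xs :
  map (fun j => f (nth j xs d)) (seq 0 (length xs)) = map f xs.
Proof.
  induction xs as [|x xs IH]; cbn; auto. f_equal. rewrite <- seq_shift, map_map. exact IH.
Qed.

Lemma home_no_marks g rho o :
  home g (length rho) (no_marks rho) o = (g, Sep :: map plain rho ++ Bar :: map plain o).
Proof.
  unfold home. rewrite <- (map_nth_seq plain KX rho).
  rewrite (map_ext_in (no_marks rho) (fun j => plain (nth j rho KX))); auto.
  intros j Hj; apply in_seq in Hj. unfold no_marks, marked_cells, at_pos, plain.
  f_equal; apply Nat.eqb_neq; lia.
Qed.

(** The garbage [g] is arbitrary, so that stages can be chained. The output length is bounded along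
    with the time because the time of the next stage depends on it. *)
Definition computes_in (p : prog) (F : list kind -> list kind) (c k : nat) : Prop :=
  forall g rho, exists g',
    ev p (c * (length rho + 1) ^ k) (Sep :: g, map plain rho) (Sep :: g', map plain (F rho)) /\
    length (F rho) + 1 <= c * (length rho + 1) ^ k.

Definition tape_computable (F : list kind -> list kind) : Prop :=
  exists p c k, computes_in p F c k.

Lemma stage_computable ps : tape_computable (stage_out ps).
Proof.
  destruct (seqs_passes_spec ps) as [c1 H1], (stage_out_length ps) as [c2 H2].
  exists (stage_prog ps), (c1 * (c2 + 3) ^ 4 + c2 + 20), 12. intros g rho.
  exists (rev (map plain rho) ++ Sep :: g).
  set (X := length rho + 1).
  assert (HX : 1 <= X) by (unfold X; lia).
  assert (X1 : X <= X ^ 12) by (rewrite <- (Nat.pow_1_r X) at 1; apply Nat.pow_le_mono_r; lia).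
  assert (X3 : X ^ 3 <= X ^ 12) by (apply Nat.pow_le_mono_r; lia).
  assert (X13 : X <= X ^ 3) by (rewrite <- (Nat.pow_1_r X) at 1; apply Nat.pow_le_mono_r; lia).
  specialize (H2 rho); fold X in H2.
  split; [|nia].
  (* Input and output together are cubic in [X] and a pass takes the fourth power of that: hence the
     exponent 12. *)
  set (W := (c2 + 3) * X ^ 3).
  assert (E : W ^ 4 = (c2 + 3) ^ 4 * X ^ 12).
  { unfold W. now rewrite Nat.pow_mul_l, <- Nat.pow_mul_r. }
  assert (Hn : forall s, In s (map plain rho) ->
    is_blank s = false /\ is_sep s = false /\ is_bar s = false).
  { intros s Hs. apply in_map_iff in Hs as (k & <- & _); auto. }
  apply ev_weaken with
    ((2 * length (map plain rho) + 1 + (1 + (2 * length (map plain rho) + 3))) +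
     (c1 * W ^ 4 + ((2 * length (Sep :: map plain rho) + 1) + 1))).
  2: { rewrite E. cbn [length]. rewrite length_map. unfold X in *. nia. }
  apply ev_seq with (home g (length rho) (no_marks rho) []); [|eapply ev_seq].
  - eapply ev_seq; [|eapply ev_seq; [apply ev_act'; reflexivity|]].
    + replace (map plain rho) with (map plain rho ++ []) at 2 by apply app_nil_r.
      apply seek_right; auto. intros; now apply Hn.
    + rewrite home_no_marks. apply go_home_spec; auto. intros; now apply Hn.
  - apply H1. unfold stage_out, W, X in *. cbn [app length]. nia.
  - rewrite home_no_marks. cbn [app]. eapply ev_seq.
    + change (Sep :: map plain rho ++ ?r) with ((Sep :: map plain rho) ++ r).
      apply seek_right; auto. intros s [<-|Hs]; auto; now apply Hn.
    + apply ev_act'. unfold scan; cbn [snd hd fst act tl]. cbn [rev]. now rewrite <- app_assoc.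
Qed.

Lemma tape_computable_comp F G :
  tape_computable F -> tape_computable G -> tape_computable (fun rho => G (F rho)).
Proof.
  intros (p & c & k & Hp) (q & d & j & Hq).
  exists (Seq p q), (c + d * c ^ j), (k + k * j). intros g rho.
  destruct (Hp g rho) as (g1 & E1 & L1), (Hq g1 (F rho)) as (g2 & E2 & L2).
  set (X := length rho + 1) in *.
  assert (A : X ^ k <= X ^ (k + k * j)) by (apply Nat.pow_le_mono_r; lia).
  assert (B : (length (F rho) + 1) ^ j <= c ^ j * X ^ (k + k * j)).
  { etransitivity; [apply Nat.pow_le_mono_l, L1|].
    rewrite Nat.pow_mul_l, <- Nat.pow_mul_r. apply Nat.mul_le_mono_l, Nat.pow_le_mono_r; lia. }
  exists g2; split; [|nia].
  eapply ev_weaken; [eapply ev_seq; [apply E1|apply E2]|nia].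
Qed.

(** The number of iterations is a constant of the program; it will be the exponent of the clock
    polynomial, so the degree may grow with it. *)
Lemma tape_computable_iter F k :
  tape_computable F -> tape_computable (Nat.iter k F).
Proof.
  intros H; induction k; cbn.
  (* A loop that is never entered leaves the tape literally unchanged, whereas [skip] would write a
     [Blank] on an empty right part. *)
  - exists (While (fun _ => false) skip), 1, 1. intros g rho; exists g; split; [|cbn; lia].
    eapply ev_weaken; [now apply ev_while_end|cbn; lia].
  - now apply (tape_computable_comp (Nat.iter k F) F).
Qed.

(** [Sep] goes to the left of the input. On the empty input it is written in place, since moving
    left and back would leave a [Blank] in the right part. *)
Definition enter : prog :=
  If is_blank (Act (fun _ => (Sep, MRight))) (Seq left (Act (fun _ => (Sep, MRight)))).

Lemma enter_spec ks : ev enter 4 ([], map plain ks) ([Sep], map plain ks).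
Proof.
  eapply ev_weaken with (n := 3); [|lia]. destruct ks as [|k ks].
  - eapply ev_weaken with (n := 2); [|lia].
    apply ev_if_true; [reflexivity|]. now apply ev_act'.
  - apply ev_if_false; [reflexivity|]. apply (ev_seq _ _ 1 1 _ _ _ (ev_act _ _)). now apply ev_act'.
Qed.

Lemma poly_time_of_tape_computable F f :
  tape_computable F -> (forall w, F (map KBit w) = map KBit (f w)) -> poly_time_computable f.
Proof.
  intros (p & c & k & H) Hf.
  exists (machine (Seq enter p)), (c * 2 ^ k + 4), k.
  split; [apply machine_deterministic|]. intros w.
  destruct (H [] (map KBit w)) as (g & E & _). rewrite Hf, length_map in E.
  destruct (machine_computes (Seq enter p) w (f w) (4 + c * (length w + 1) ^ k) (Sep :: g))
    as (n & l & r' & Ln & S & B).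
  { rewrite <- !(map_map KBit plain). eapply ev_seq; [apply enter_spec|exact E]. }
  exists n, l, r'; repeat split; auto; try eapply B; eauto.
  unfold poly_bound. etransitivity; [exact Ln|].
  (* Powers of [n + 1] are brought to the shape of [poly_bound]: [n + 1] is at most [2 * n] unless
     [n = 0]. *)
  assert (L : (length w + 1) ^ k <= 2 ^ k * length w ^ k + 2 ^ k).
  { destruct (length w) as [|m].
    - cbn. rewrite Nat.pow_1_l. pose proof (Nat.pow_nonzero 2 k); lia.
    - rewrite <- Nat.pow_mul_l. etransitivity; [|apply Nat.le_add_r].
      apply Nat.pow_le_mono_l; lia. }
  nia.
Qed.

(** * The encoding of databases *)

Lemma tok_digits_inj bs bs' u v :
  flat_map tok_digit bs ++ tok_endnum ++ u = flat_map tok_digit bs' ++ tok_endnum ++ v ->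
  bs = bs' /\ u = v.
Proof.
  revert bs'; induction bs as [|b bs IH]; intros [|b' bs']; cbn; intros H; try discriminate.
  - inversion H; auto.
  - inversion H. destruct (IH bs') as [-> ->]; auto.
Qed.

Lemma pos_bits_nonnil p : pos_bits p <> [].
Proof. now destruct p. Qed.

Lemma pos_bits_inj p q : pos_bits p = pos_bits q -> p = q.
Proof.
  revert q; induction p; intros [q|q|]; cbn; intros H; inversion H; auto; try (f_equal; auto);
    exfalso; eapply pos_bits_nonnil; eauto.
Qed.

Lemma nat_bits_inj n m : nat_bits n = nat_bits m -> n = m.
Proof.
  unfold nat_bits; intros H. apply Nat2N.inj.
  destruct (N.of_nat n), (N.of_nat m); auto.
  - symmetry in H; now apply pos_bits_nonnil in H.
  - now apply pos_bits_nonnil in H.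
  - now apply pos_bits_inj in H as ->.
Qed.

Lemma enc_nat_inj n m u v : enc_nat n ++ u = enc_nat m ++ v -> n = m /\ u = v.
Proof.
  unfold enc_nat. rewrite <- !app_assoc. intros H.
  apply tok_digits_inj in H as [H ->]; auto using nat_bits_inj.
Qed.

(** The first token of a number is a digit or [tok_endnum], never [tok_endfact] or [tok_enddb]: this
    makes lists of numbers and of facts uniquely readable. *)
Lemma enc_nat_head n u : exists b s, enc_nat n ++ u = false :: b :: s /\
  (b = true -> exists s', s = false :: s').
Proof.
  unfold enc_nat. destruct (nat_bits n) as [|b bs]; cbn; do 2 eexists; split; eauto; discriminate.
Qed.

Lemma enc_nats_inj cs cs' u v :
  flat_map enc_nat cs ++ tok_endfact ++ u = flat_map enc_nat cs' ++ tok_endfact ++ v ->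
  cs = cs' /\ u = v.
Proof.
  revert cs'; induction cs as [|c cs IH]; intros [|c' cs']; cbn -[enc_nat]; intros H.
  - inversion H; auto.
  - exfalso. rewrite <- app_assoc in H.
    destruct (enc_nat_head c' (flat_map enc_nat cs' ++ tok_endfact ++ v)) as (b & s & E & N).
    cbn -[enc_nat] in E. rewrite E in H; inversion H; subst.
    destruct N as [s' N]; auto; discriminate.
  - exfalso. rewrite <- app_assoc in H.
    destruct (enc_nat_head c (flat_map enc_nat cs ++ tok_endfact ++ u)) as (b & s & E & N).
    cbn -[enc_nat] in E. rewrite E in H; inversion H; subst.
    destruct N as [s' N]; auto; discriminate.
  - rewrite <- !app_assoc in H. apply enc_nat_inj in H as [-> H].
    apply IH in H as [-> ->]; auto.
Qed.

Lemma enc_facts_inj D D' u v :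
  flat_map enc_fact D ++ tok_enddb ++ u = flat_map enc_fact D' ++ tok_enddb ++ v -> D = D' /\ u = v.
Proof.
  revert D'; induction D as [|[p cs] D IH]; intros [|[p' cs'] D']; cbn -[enc_fact]; intros H.
  - inversion H; auto.
  - exfalso. unfold enc_fact in H. rewrite <- !app_assoc in H. cbn [fst] in H.
    match type of H with _ = enc_nat ?n ++ ?r => destruct (enc_nat_head n r) as (b & s & E & _) end.
    rewrite E in H; discriminate.
  - exfalso. unfold enc_fact in H. rewrite <- !app_assoc in H. cbn [fst] in H.
    match type of H with enc_nat ?n ++ ?r = _ => destruct (enc_nat_head n r) as (b & s & E & _) end.
    rewrite E in H; discriminate.
  - unfold enc_fact in H. cbn [fst snd] in H. rewrite <- !app_assoc in H.
    apply enc_nat_inj in H as [-> H]. apply enc_nats_inj in H as [-> H].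
    apply IH in H as [-> ->]; auto.
Qed.

(** [repair_checking] asks for some pair with the given code; uniqueness identifies it with the pair
    that the reduction has encoded. *)
Lemma enc_pair_inj D1 D1' D2 D2' :
  enc_pair D1 D1' = enc_pair D2 D2' -> D1 = D2 /\ D1' = D2'.
Proof.
  unfold enc_pair, enc_db. rewrite <- !app_assoc. intros H.
  apply enc_facts_inj in H as [-> H]. rewrite <- (app_nil_r tok_enddb) in H.
  apply enc_facts_inj in H as [-> _]; auto.
Qed.

Definition name (j : nat) : nat := Pos.to_nat (Nat.iter j xO xH).

Lemma nat_bits_name j : nat_bits (name j) = repeat false j ++ [true].
Proof.
  unfold nat_bits, name. change (Pos.to_nat ?p) with (N.to_nat (Npos p)).
  rewrite N2Nat.id. induction j as [|j IH]; cbn in *; [auto|]. f_equal; exact IH.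
Qed.

Lemma name_inj i j : name i = name j -> i = j.
Proof.
  intros H. apply (f_equal nat_bits), (f_equal (@length bool)) in H.
  rewrite !nat_bits_name, !length_app, !repeat_length in H. cbn in H; lia.
Qed.

(** * The dependencies *)

Definition slot : psym := PName 0.
Definition item : psym := PName 1.
Definition conf : psym := PName 2.
Definition go : psym := PName 3.

Definition sg : signature := {| sig_preds := [(0, 2); (1, 3); (2, 6); (3, 0)] |}.

Definition dep_slot : dependency := {|
  dep_body := [LAtom slot [TVar 0; TVar 1]; LAtom go []];
  dep_head := [{| cq_ex := [2]; cq_body := [LAtom item [TVar 0; TVar 1; TVar 2]] |}] |}.

Definition dep_go : dependency := {|
  dep_body := [LAtom item [TVar 3; TVar 4; TVar 5]];
  dep_head := [{| cq_ex := []; cq_body := [LAtom go []] |}] |}.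

(* Having no atom in its head, this dependency has no marked variable. *)
Definition dep_conf : dependency := {|
  dep_body := [LAtom conf [TVar 6; TVar 7; TVar 8; TVar 9; TVar 10; TVar 11];
               LAtom item [TVar 6; TVar 7; TVar 8]; LAtom item [TVar 9; TVar 10; TVar 11]];
  dep_head := [{| cq_ex := []; cq_body := [LNeq (TConst 0) (TConst 0)] |}] |}.

Definition deps : list dependency := [dep_slot; dep_go; dep_conf].

Lemma sg_wf : sig_wf sg.
Proof. unfold sig_wf; cbn. repeat constructor; cbn; lia. Qed.

Lemma deps_wf : Forall (wf_dep sg) deps.
Proof.
  assert (W : forall c p ts x, In (LAtom p ts) c -> In x (terms_vars ts) -> in_some_atom c x)
    by (intros; do 2 eexists; eauto).
  apply Forall_forall; intros d [<-|[<-|[<-|[]]]];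
    (split; [split; [discriminate|]|split; [|split; [discriminate|intros q [<-|[]]]]]).
  all: try (cbn; intros p ts H; repeat destruct H as [H|H]; inversion H; subst; cbn; tauto).
  1: intros x H; apply (W _ slot [TVar 0; TVar 1]); cbn in *; tauto.
  2: intros x H; apply (W _ item [TVar 3; TVar 4; TVar 5]); cbn in *; tauto.
  3: intros x H; apply (W _ conf [TVar 6; TVar 7; TVar 8; TVar 9; TVar 10; TVar 11]);
     cbn in *; tauto.
  all: split; [split; [split; [discriminate|]|]|]; cbn; try tauto.
  all: try (intros p ts H; repeat destruct H as [H|H]; inversion H; subst; cbn; tauto).
  intros y [<-|[]]. apply (W _ item [TVar 0; TVar 1; TVar 2]); cbn; tauto.
Qed.

Lemma deps_guarded : Forall guarded deps.
Proof.
  repeat constructor; unfold guarded.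
  - exists slot, [TVar 0; TVar 1]; cbn; tauto.
  - exists item, [TVar 3; TVar 4; TVar 5]; cbn; tauto.
  - exists conf, [TVar 6; TVar 7; TVar 8; TVar 9; TVar 10; TVar 11]; cbn; tauto.
Qed.

(** Only the body of [dep_conf] repeats variables, and none of these is marked; the other two bodies
    have no repetition, whatever is marked there. *)
Lemma deps_sticky : sticky deps.
Proof.
  split.
  - intros i j Hi Hj Hij x. cbn in Hi, Hj.
    destruct i as [|[|[|i]]], j as [|[|[|j]]]; try lia; cbn; intuition lia.
  - intros d x Hd Hm. assert (N : d <> dep_conf).
    { intros ->. inversion Hm; subst; cbn in *; firstorder discriminate. }
    apply NoDup_count_occ. destruct Hd as [<-|[<-|[<-|[]]]]; try easy;
      repeat constructor; cbn; intuition lia.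
Qed.

(** * Tilings and repairs *)

(** Arguments are relative to the current pair of positions: a neighbour is an offset of 1, and no
    position is ever computed. *)
Inductive arg := ARow (d : nat) | ACol (d : nat) | AConst (c : nat).

Definition inst_arg (t i : nat) (a : arg) : nat :=
  match a with ARow d => name (t + d) | ACol d => name (i + d) | AConst c => c end.

Definition template := (nat * list arg)%type.

Definition inst (t i : nat) (f : template) : fact := (fst f, map (inst_arg t i) (snd f)).

Definition grid (tm : kind -> kind -> list template) (rho : list kind) : database :=
  flat_map (fun t => flat_map (fun i => map (inst t i) (tm (at_pos rho t) (at_pos rho i)))
    (seq 0 (length rho))) (seq 0 (length rho)).

Lemma in_grid f tm rho :
  In f (grid tm rho) <-> exists t i e, t < length rho /\ i < length rho /\
    In e (tm (at_pos rho t) (at_pos rho i)) /\ f = inst t i e.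
Proof.
  unfold grid. rewrite in_flat_map. split.
  - intros (t & Ht & H). apply in_flat_map in H as (i & Hi & H).
    apply in_map_iff in H as (e & <- & H).
    apply in_seq in Ht, Hi. exists t, i, e; repeat split; auto; lia.
  - intros (t & i & e & Ht & Hi & H & ->). exists t; split; [apply in_seq; lia|].
    apply in_flat_map. exists i; split; [apply in_seq; lia|]. apply in_map; auto.
Qed.

(** * Printing the databases by passes *)

Definition arg_pieces (a : arg) : list piece :=
  let number d := map (fun b => PSym (KBit b))
    (flat_map tok_digit (repeat false d ++ [true]) ++ tok_endnum) in
  match a with
  | ARow d => PRow (KBit false) :: PRow (KBit false) :: PRow (KBit false) :: number d
  | ACol d => PCol (KBit false) :: PCol (KBit false) :: PCol (KBit false) :: number d
  | AConst c => map (fun b => PSym (KBit b)) (enc_nat c)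
  end.

Definition template_pieces (e : template) : list piece :=
  map (fun b => PSym (KBit b)) (enc_nat (fst e)) ++ flat_map arg_pieces (snd e) ++
  map (fun b => PSym (KBit b)) tok_endfact.

Definition grid_pass (tm : kind -> kind -> list template) : pass :=
  PDouble (fun a b => flat_map template_pieces (tm a b)).

Lemma pieces_bits t i bs :
  flat_map (piece_out t i) (map (fun b => PSym (KBit b)) bs) = map KBit bs.
Proof. induction bs; cbn; congruence. Qed.

Lemma repeat_digits j : flat_map tok_digit (repeat false j) = repeat false (j + (j + j)).
Proof.
  induction j as [|j IH]; auto. replace (S j + (S j + S j)) with (S (S (S (j + (j + j))))) by lia.
  cbn. now rewrite IH.
Qed.

(** The digit 0 is a token of three [false] bits, so the code of [name (d + d')] is three unary runs
    of length [d] followed by a word depending on [d'] only. *)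
Lemma pieces_name t i p d :
  flat_map (piece_out t i) [p; p; p] = map KBit (repeat false (d + (d + d))) ->
  forall d', flat_map (piece_out t i) (p :: p :: p :: map (fun b => PSym (KBit b))
    (flat_map tok_digit (repeat false d' ++ [true]) ++ tok_endnum))
  = map KBit (enc_nat (name (d + d'))).
Proof.
  intros H d'. change (p :: p :: p :: ?l) with ([p; p; p] ++ l).
  rewrite flat_map_app, H, pieces_bits. unfold enc_nat.
  rewrite nat_bits_name, (repeat_app false d d'), <- map_app, <- app_assoc,
    (flat_map_app _ (repeat false d)), repeat_digits. now rewrite app_assoc.
Qed.

Lemma arg_pieces_out t i a :
  flat_map (piece_out t i) (arg_pieces a) = map KBit (enc_nat (inst_arg t i a)).
Proof.
  destruct a as [d|d|c]; cbn [arg_pieces inst_arg]; [| |apply pieces_bits];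
    apply pieces_name; cbn; now rewrite app_nil_r, !map_repeat, !repeat_app.
Qed.

Lemma template_pieces_out t i e :
  flat_map (piece_out t i) (template_pieces e) = map KBit (enc_fact (inst t i e)).
Proof.
  unfold template_pieces, enc_fact, inst. rewrite !flat_map_app, !pieces_bits, !map_app.
  f_equal; f_equal. cbn [snd]. induction (snd e) as [|a l IH]; auto.
  cbn -[arg_pieces enc_nat]. now rewrite flat_map_app, arg_pieces_out, map_app, IH.
Qed.

Lemma flat_map_map_out {A B C} (f : A -> list B) (g : B -> C) (h : A -> list C) xs :
  (forall x, In x xs -> h x = map g (f x)) -> flat_map h xs = map g (flat_map f xs).
Proof.
  induction xs as [|x xs IH]; cbn; intros H; auto. rewrite map_app, H, IH; auto.
Qed.

Lemma flat_map_flat_map {A B C} (f : A -> list B) (g : B -> list C) xs :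
  flat_map g (flat_map f xs) = flat_map (fun x => flat_map g (f x)) xs.
Proof. induction xs; cbn; auto. rewrite flat_map_app; congruence. Qed.

Lemma grid_pass_out tm rho :
  pass_out rho (grid_pass tm) = map KBit (flat_map enc_fact (grid tm rho)).
Proof.
  unfold grid; cbn. rewrite flat_map_flat_map. apply flat_map_map_out. intros t _.
  rewrite flat_map_flat_map. apply flat_map_map_out. intros i _.
  induction (tm _ _) as [|e l IH]; auto.
  cbn -[template_pieces enc_fact]. now rewrite flat_map_app, template_pieces_out, map_app, IH.
Qed.

Section Grid.

Variables (m : nat) (is_row : kind -> bool) (ok : kind -> kind -> nat -> bool).
Variables (hc vc : nat -> nat -> bool).

(** Conflicts with neighbours outside the grid are listed as well; they are harmless, because no
    item of [db] lies there. *)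
Definition fixed_templates (a b : kind) : list template :=
  if is_row a then
    (0, [ARow 0; ACol 0]) ::
    flat_map (fun '(x, y) =>
      (if hc x y then [] else [(2, [ARow 0; ACol 0; AConst x; ARow 0; ACol 1; AConst y])]) ++
      (if vc x y then [] else [(2, [ARow 0; ACol 0; AConst x; ARow 1; ACol 0; AConst y])]))
      (list_prod (seq 0 m) (seq 0 m))
  else [].

Definition item_templates (a b : kind) : list template :=
  if is_row a then
    map (fun x => (1, [ARow 0; ACol 0; AConst x])) (filter (ok a b) (seq 0 m))
  else [].

Definition all_templates (a b : kind) : list template :=
  fixed_templates a b ++ item_templates a b.

Definition db (rho : list kind) : database := (3, []) :: grid all_templates rho.
Definition subdb (rho : list kind) : database := grid fixed_templates rho.

Definition db_passes : list pass :=
  [PLit (map KBit (enc_fact (3, []))); grid_pass all_templates; PLit (map KBit tok_enddb);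
   grid_pass fixed_templates; PLit (map KBit tok_enddb)].

Lemma db_passes_out rho : stage_out db_passes rho = map KBit (enc_pair (db rho) (subdb rho)).
Proof.
  unfold stage_out, db_passes, enc_pair, enc_db, db, subdb.
  cbn [flat_map]. rewrite !grid_pass_out, !map_app, <- !app_assoc. now rewrite app_nil_r.
Qed.

Definition tiling (rho : list kind) (th : nat -> nat -> nat) : Prop :=
  forall t i, t < length rho -> i < length rho -> is_row (at_pos rho t) = true ->
    th t i < m /\ ok (at_pos rho t) (at_pos rho i) (th t i) = true /\
    (S i < length rho -> hc (th t i) (th t (S i)) = true) /\
    (S t < length rho -> is_row (at_pos rho (S t)) = true -> vc (th t i) (th (S t) i) = true).

Lemma in_subdb f rho :
  In f (subdb rho) <-> exists t i,
    t < length rho /\ i < length rho /\ is_row (at_pos rho t) = true /\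
    (f = (0, [name t; name i]) \/
     exists x y, x < m /\ y < m /\
       (hc x y = false /\ f = (2, [name t; name i; x; name t; name (S i); y]) \/
        vc x y = false /\ f = (2, [name t; name i; x; name (S t); name i; y]))).
Proof.
  unfold subdb; rewrite in_grid. unfold fixed_templates. split.
  - intros (t & i & e & Ht & Hi & He & ->). destruct (is_row (at_pos rho t)) eqn:R; [|easy].
    exists t, i; repeat split; auto. destruct He as [<-|He].
    + left. unfold inst; cbn. now rewrite !Nat.add_0_r.
    + right. apply in_flat_map in He as ([x y] & Hxy & He). apply in_prod_iff in Hxy as [Hx Hy].
      apply in_seq in Hx, Hy. exists x, y; split; [lia|]; split; [lia|].
      destruct (hc x y) eqn:H, (vc x y) eqn:V; cbn in He;
        repeat destruct He as [<-|He]; try easy; [right|left|left|right];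
        split; auto; unfold inst; cbn; now rewrite ?Nat.add_0_r, ?Nat.add_1_r.
  - intros (t & i & Ht & Hi & R & H). destruct H as [->|(x & y & Hx & Hy & H)].
    + exists t, i, (0, [ARow 0; ACol 0]); rewrite R; repeat split; auto; [now left|].
      unfold inst; cbn. now rewrite !Nat.add_0_r.
    + destruct H as [[E ->]|[E ->]].
      * exists t, i, (2, [ARow 0; ACol 0; AConst x; ARow 0; ACol 1; AConst y]).
        rewrite R; repeat split; auto; [|unfold inst; cbn; now rewrite ?Nat.add_0_r, ?Nat.add_1_r].
        right. apply in_flat_map. exists (x, y). split; [apply in_prod; apply in_seq; lia|].
        rewrite E. now left.
      * exists t, i, (2, [ARow 0; ACol 0; AConst x; ARow 1; ACol 0; AConst y]).
        rewrite R; repeat split; auto; [|unfold inst; cbn; now rewrite ?Nat.add_0_r, ?Nat.add_1_r].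
        right. apply in_flat_map. exists (x, y). split; [apply in_prod; apply in_seq; lia|].
        rewrite E. apply in_or_app; right; now left.
Qed.

Lemma in_db f rho :
  In f (db rho) <-> f = (3, []) \/ In f (subdb rho) \/
    exists t i x, t < length rho /\ i < length rho /\ is_row (at_pos rho t) = true /\
      x < m /\ ok (at_pos rho t) (at_pos rho i) x = true /\ f = (1, [name t; name i; x]).
Proof.
  unfold db, subdb; cbn [In]. rewrite !in_grid. unfold all_templates, item_templates. split.
  - intros [<-|(t & i & e & Ht & Hi & He & ->)]; [now left|right].
    apply in_app_or in He as [He|He]; [left; now exists t, i, e|right].
    destruct (is_row (at_pos rho t)) eqn:R; [|easy].
    apply in_map_iff in He as (x & <- & Hx). apply filter_In in Hx as [Hx Hok]. apply in_seq in Hx.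
    exists t, i, x; repeat split; auto; [lia|]. unfold inst; cbn. now rewrite !Nat.add_0_r.
  - intros [->|[(t & i & e & Ht & Hi & He & ->)|(t & i & x & Ht & Hi & R & Hx & Hok & ->)]];
      [now left|right..].
    + exists t, i, e; repeat split; auto. apply in_or_app; auto.
    + exists t, i, (1, [ARow 0; ACol 0; AConst x]); repeat split; auto;
        [|unfold inst; cbn; now rewrite !Nat.add_0_r].
      apply in_or_app; right. rewrite R. apply in_map_iff. exists x; split; auto.
      apply filter_In; split; auto. apply in_seq; lia.
Qed.

Lemma db_over_sg rho : db_over sg (db rho) /\ db_over sg (subdb rho).
Proof.
  assert (H : db_over sg (db rho)).
  { intros n cs H. apply in_db in H as [E|[H|(t & i & x & _ & _ & _ & _ & _ & E)]];
      try (inversion E; cbn; tauto).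
    apply in_subdb in H as (t & i & _ & _ & _ & [E|(x & y & _ & _ & [[_ E]|[_ E]])]);
      inversion E; cbn; tauto. }
  split; auto. intros n cs Hn. apply H, in_db; auto.
Qed.

(** * Repairs of the databases and tilings of the grid *)

Lemma fact_eq_dec (f g : fact) : {f = g} + {f <> g}.
Proof. repeat decide equality. Qed.

Lemma satisfies_slot D :
  satisfies D dep_slot <->
  (forall a b, In (0, [a; b]) D -> In (3, []) D -> exists c, In (1, [a; b; c]) D).
Proof.
  split.
  - intros H a b Ha Hg. destruct (H (fun x => if x =? 0 then a else b))
      as (q & [<-|[]] & h & E & Hh).
    + intros l [<-|[<-|[]]]; auto.
    + exists (h 2). specialize (Hh _ (or_introl eq_refl)). cbn in Hh.
      rewrite !E in Hh by (cbn; lia). exact Hh.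
  - intros H h Hb. destruct (H (h 0) (h 1)) as [c Hc].
    + apply (Hb (LAtom slot [TVar 0; TVar 1])); now left.
    + apply (Hb (LAtom go [])); right; now left.
    + eexists; split; [now left|]. exists (fun x => if x =? 2 then c else h x); split.
      * intros x Hx. destruct (Nat.eqb_spec x 2); auto. destruct Hx; cbn; auto.
      * intros l [<-|[]]; exact Hc.
Qed.

Lemma satisfies_go D :
  satisfies D dep_go <-> (forall a b c, In (1, [a; b; c]) D -> In (3, []) D).
Proof.
  split.
  - intros H a b c Ha.
    destruct (H (fun x => if x =? 3 then a else if x =? 4 then b else c))
      as (q & [<-|[]] & h & _ & Hh).
    + intros l [<-|[]]; auto.
    + exact (Hh _ (or_introl eq_refl)).
  - intros H h Hb. eexists; split; [now left|]. exists h; split; auto.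
    intros l [<-|[]]. eapply H. apply (Hb (LAtom item [TVar 3; TVar 4; TVar 5])); now left.
Qed.

Lemma satisfies_conf D :
  satisfies D dep_conf <->
  (forall a b c a' b' c', In (2, [a; b; c; a'; b'; c']) D ->
     In (1, [a; b; c]) D -> In (1, [a'; b'; c']) D -> False).
Proof.
  split.
  - intros H a b c a' b' c' H1 H2 H3.
    (* The variables of [dep_conf] are 6 to 11, hence the shift. *)
    destruct (H (fun x => nth (x - 6) [a; b; c; a'; b'; c'] 0)) as (q & [<-|[]] & h & _ & Hh).
    + intros l [<-|[<-|[<-|[]]]]; auto.
    + now apply (Hh _ (or_introl eq_refl)).
  - intros H h Hb. exfalso. apply (H (h 6) (h 7) (h 8) (h 9) (h 10) (h 11)).
    + apply (Hb (LAtom conf [TVar 6; TVar 7; TVar 8; TVar 9; TVar 10; TVar 11])); now left.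
    + apply (Hb (LAtom item [TVar 6; TVar 7; TVar 8])); right; now left.
    + apply (Hb (LAtom item [TVar 9; TVar 10; TVar 11])); right; right; now left.
Qed.

Lemma consistent_deps D :
  consistent deps D <-> satisfies D dep_slot /\ satisfies D dep_go /\ satisfies D dep_conf.
Proof.
  unfold consistent, deps; cbn. split.
  - intros H; repeat split; apply H; auto.
  - intros (H1 & H2 & H3) d [<-|[<-|[<-|[]]]]; auto.
Qed.

Lemma subdb_no_item rho n cs : In (n, cs) (subdb rho) -> n = 0 \/ n = 2.
Proof.
  intros H. apply in_subdb in H as (t & i & _ & _ & _ & [E|(x & y & _ & _ & [[_ E]|[_ E]])]);
    inversion E; auto.
Qed.

Lemma subdb_consistent rho : consistent deps (subdb rho).
Proof.
  rewrite consistent_deps, satisfies_slot, satisfies_go, satisfies_conf. repeat split.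
  - intros a b _ H. apply subdb_no_item in H; lia.
  - intros a b c H. apply subdb_no_item in H; lia.
  - intros * _ H _. apply subdb_no_item in H; lia.
Qed.

(** The items of the tiling together with [go] extend [subdb] consistently inside [db]; maximality
    would put [go] into [subdb], which has only slots and conflicts. *)
Lemma tiling_not_repair rho th : tiling rho th -> ~ is_repair deps (db rho) (subdb rho).
Proof.
  intros Hth (_ & _ & Hmax).
  set (items := flat_map (fun t => if is_row (at_pos rho t)
    then map (fun i => (1, [name t; name i; th t i])) (seq 0 (length rho)) else [])
    (seq 0 (length rho))).
  assert (Hit : forall f, In f items <-> exists t i, t < length rho /\ i < length rho /\
    is_row (at_pos rho t) = true /\ f = (1, [name t; name i; th t i])).
  { intros f. unfold items. rewrite in_flat_map. split.
    - intros (t & Ht & H). destruct (is_row _) eqn:R; [|easy].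
      apply in_map_iff in H as (i & <- & Hi). apply in_seq in Ht, Hi.
      exists t, i; repeat split; auto; lia.
    - intros (t & i & Ht & Hi & R & ->). exists t; split; [apply in_seq; lia|]. rewrite R.
      apply in_map_iff. exists i; split; auto. apply in_seq; lia. }
  assert (Hin : forall f, In f ((3, []) :: subdb rho ++ items) <->
    f = (3, []) \/ In f (subdb rho) \/ In f items).
  { intros f; cbn [In]. rewrite in_app_iff. intuition congruence. }
  assert (Hi1 : forall a b c, In (1, [a; b; c]) ((3, []) :: subdb rho ++ items) ->
    exists t i, t < length rho /\ i < length rho /\ is_row (at_pos rho t) = true /\
    a = name t /\ b = name i /\ c = th t i).
  { intros a b c H. apply Hin in H as [H|[H|H]]; [discriminate|apply subdb_no_item in H; lia|].
    apply Hit in H as (t & i & Ht & Hi & R & E). inversion E; subst. exists t, i; auto 7. }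
  assert (Hgo : In (3, []) (subdb rho)); [|apply subdb_no_item in Hgo; lia].
  apply (Hmax ((3, []) :: subdb rho ++ items)); [..|now left].
  - intros f Hf. apply Hin; auto.
  - intros f Hf. apply in_db. apply Hin in Hf as [Hf|[Hf|Hf]]; auto.
    apply Hit in Hf as (t & i & Ht & Hi & R & ->). right; right.
    destruct (Hth t i Ht Hi R) as (H1 & H2 & _). exists t, i, (th t i); auto 7.
  - rewrite consistent_deps, satisfies_slot, satisfies_go, satisfies_conf. repeat split.
    + intros a b H _. apply Hin in H as [H|[H|H]]; [discriminate| |].
      * apply in_subdb in H as (t & i & Ht & Hi & R & [E|(x & y & _ & _ & [[_ E]|[_ E]])]);
          inversion E; subst. exists (th t i). apply Hin; right; right.
        apply Hit. exists t, i; auto.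
      * apply Hit in H as (t & i & _ & _ & _ & E). discriminate.
    + intros; now left.
    (* Both items belong to the tiling, so the neighbouring cell lies inside the grid, as [HH] and
       [HV] require. *)
    + intros a b c a' b' c' H H1 H2.
      apply Hi1 in H1 as (t & i & Ht & Hi & R & -> & -> & ->).
      apply Hi1 in H2 as (t' & i' & Ht' & Hi' & R' & -> & -> & ->).
      destruct (Hth t i Ht Hi R) as (_ & _ & HH & HV).
      apply Hin in H as [H|[H|H]]; [discriminate| |].
      * apply in_subdb in H as (u & j & _ & _ & _ & [E|(x & y & _ & _ & [[F E]|[F E]])]);
          inversion E; subst.
        -- apply name_inj in H0 as ->; apply name_inj in H1 as ->.
           apply name_inj in H3 as ->; apply name_inj in H4 as ->.
           rewrite HH in F; auto; discriminate.
        -- apply name_inj in H0 as ->; apply name_inj in H1 as ->.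
           apply name_inj in H3 as ->; apply name_inj in H4 as ->.
           rewrite HV in F; auto; discriminate.
      * apply Hit in H as (u & j & _ & _ & _ & E). discriminate.
Qed.

Lemma no_tiling_repair rho :
  ~ (exists th, tiling rho th) -> is_repair deps (db rho) (subdb rho).
Proof.
  intros Hno. split; [|split].
  - intros f Hf. apply in_db; auto.
  - apply subdb_consistent.
  - intros D Hsub HD Hcon f Hf.
    destruct (in_dec fact_eq_dec f (subdb rho)) as [Hs|Hs]; auto.
    exfalso; apply Hno.
    rewrite consistent_deps, satisfies_slot, satisfies_go, satisfies_conf in Hcon.
    destruct Hcon as (C1 & C2 & C3).
    (* A fact outside [subdb] is [go] or an item, and an item yields [go] by [dep_go]. *)
    assert (Hgo : In (3, []) D).
    { destruct (proj1 (in_db _ _) (HD f Hf)) as [->|[H|(t & i & x & _ & _ & _ & _ & _ & ->)]];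
        [auto|contradiction|eauto]. }
    (* A slot may hold several items of [D]. Any choice works, since [dep_conf] excludes every
       mismatched pair; [find] takes the least tile. *)
    set (chosen t i x := if in_dec fact_eq_dec (1, [name t; name i; x]) D then true else false).
    exists (fun t i => match find (chosen t i) (seq 0 m) with Some x => x | None => 0 end).
    assert (Hc : forall t i, t < length rho -> i < length rho -> is_row (at_pos rho t) = true ->
      exists x, find (chosen t i) (seq 0 m) = Some x /\ In (1, [name t; name i; x]) D /\
        x < m /\ ok (at_pos rho t) (at_pos rho i) x = true).
    { intros t i Ht Hi R.
      assert (H : forall x, In (1, [name t; name i; x]) D ->
        x < m /\ ok (at_pos rho t) (at_pos rho i) x = true).
      { intros x Hx. apply HD, in_db in Hx as [E|[H|(t' & i' & x' & _ & _ & _ & Hx & Hok & E)]];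
          [discriminate|apply subdb_no_item in H; lia|].
        inversion E; subst. apply name_inj in H0 as ->; apply name_inj in H1 as ->; auto. }
      destruct (C1 (name t) (name i)) as [c Hc]; auto.
      { apply Hsub, in_subdb. exists t, i; auto. }
      destruct (find (chosen t i) (seq 0 m)) as [x|] eqn:F.
      - apply find_some in F as [_ F]. unfold chosen in F.
        destruct (in_dec _ _ _) as [Hx|]; [|discriminate]. exists x; auto.
      - exfalso. apply find_none with (x := c) in F; [|apply in_seq; apply H in Hc; lia].
        unfold chosen in F. destruct (in_dec _ _ _); [discriminate|contradiction]. }
    intros t i Ht Hi R. destruct (Hc t i Ht Hi R) as (x & -> & HxD & Hx & Hok).
    repeat split; auto.
    + intros Hi'. destruct (Hc t (S i) Ht Hi' R) as (y & -> & HyD & Hy & _).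
      destruct (hc x y) eqn:E; auto. exfalso.
      eapply C3; [|exact HxD|exact HyD]. apply Hsub, in_subdb. exists t, i; repeat split; auto.
      right. exists x, y; auto 6.
    + intros Ht' R'. destruct (Hc (S t) i Ht' Hi R') as (y & -> & HyD & Hy & _).
      destruct (vc x y) eqn:E; auto. exfalso.
      eapply C3; [|exact HxD|exact HyD]. apply Hsub, in_subdb. exists t, i; repeat split; auto.
      right. exists x, y; auto 6.
Qed.

Lemma repair_checking_db rho :
  repair_checking sg deps (enc_pair (db rho) (subdb rho)) <-> ~ exists th, tiling rho th.
Proof.
  split.
  - intros (D & D' & _ & _ & E & H) [th Hth]. apply enc_pair_inj in E as [<- <-].
    exact (tiling_not_repair rho th Hth H).
  - intros H. destruct (db_over_sg rho). exists (db rho), (subdb rho); repeat split; auto;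
      now apply no_tiling_repair.
Qed.

End Grid.

(** * The grid *)

Definition bits_of (k : kind) : list kind := match k with KBit b => [KBit b] | _ => [] end.
Definition blanks_as (k' k : kind) : list kind := match k with KX => [k'] | _ => [] end.

Definition init_passes (c : nat) : list pass := [PSingle bits_of; PLit (repeat KX c)].

(** The [KX] are a unary counter: one [KX] per pair of a [KX] and a bit multiplies it by the input
    length. *)
Definition mul_passes : list pass :=
  [PSingle bits_of;
   PDouble (fun a b => match a, b with KX, KBit _ => [PSym KX] | _, _ => [] end)].

Definition ruler_passes (c : nat) : list pass :=
  [PLit [KZ]; PSingle (blanks_as KM); PLit (repeat KM c ++ [KL]); PSingle bits_of;
   PSingle (blanks_as KX); PLit (repeat KX (S c) ++ [KE])].

(* Rows of the tableau are the positions of kind [KZ], [KM], [KL]: an input row,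
   [T] computation rows and an acceptance row. Every position is a column; the
   columns [KZ] and [KE] are walls and the head starts just after [KL]. *)
Definition ruler (w : list bool) (T : nat) : list kind :=
  KZ :: repeat KM T ++ KL :: map KBit w ++ repeat KX (S T) ++ [KE].

Lemma flat_map_at_pos {B} (f : kind -> list B) rho :
  flat_map (fun j => f (at_pos rho j)) (seq 0 (length rho)) = flat_map f rho.
Proof. unfold at_pos. now rewrite flat_map_concat_map, map_nth_seq, <- flat_map_concat_map. Qed.

Lemma flat_map_nil {A B} (f : A -> list B) xs :
  (forall x, In x xs -> f x = []) -> flat_map f xs = [].
Proof.
  intros H; induction xs; cbn; auto. rewrite H, IHxs; cbn; auto.
  intros; apply H; cbn; auto.
Qed.

Lemma bits_of_bits w : flat_map bits_of (map KBit w) = map KBit w.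
Proof. induction w; cbn; congruence. Qed.

Lemma blanks_as_bits k w : flat_map (blanks_as k) (map KBit w) = [].
Proof. now induction w. Qed.

Lemma bits_of_blanks m : flat_map bits_of (repeat KX m) = [].
Proof. now induction m. Qed.

Lemma blanks_as_blanks k m : flat_map (blanks_as k) (repeat KX m) = repeat k m.
Proof. induction m; cbn; congruence. Qed.

Lemma init_passes_out c w :
  stage_out (init_passes c) (map KBit w) = map KBit w ++ repeat KX c.
Proof.
  unfold stage_out; cbn [init_passes flat_map pass_out].
  now rewrite flat_map_at_pos, bits_of_bits, app_nil_r.
Qed.

Lemma mul_passes_out w m :
  stage_out mul_passes (map KBit w ++ repeat KX m) = map KBit w ++ repeat KX (m * length w).
Proof.
  unfold stage_out; cbn [mul_passes flat_map pass_out]. set (rho := map KBit w ++ repeat KX m).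
  rewrite flat_map_at_pos, app_nil_r. f_equal.
  { unfold rho. now rewrite flat_map_app, bits_of_bits, bits_of_blanks, app_nil_r. }
  set (f a := match a with KX => repeat KX (length w) | _ => [] end).
  set (h b := match b with KBit _ => [KX] | _ => [] end).
  rewrite (flat_map_ext _ (fun t => f (at_pos rho t))).
  - rewrite (flat_map_at_pos f). unfold rho. rewrite flat_map_app.
    rewrite (flat_map_nil f (map KBit w))
      by (intros x Hx; now apply in_map_iff in Hx as (b & <- & _)).
    clear rho. cbn [app]. induction m as [|m IH]; cbn; auto. rewrite repeat_app. f_equal. exact IH.
  - intros t. destruct (at_pos rho t); try (apply flat_map_nil; reflexivity).
    rewrite (flat_map_ext _ (fun i => h (at_pos rho i)))
      by (intros i; destruct (at_pos rho i); reflexivity).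
    rewrite (flat_map_at_pos h). unfold rho. rewrite flat_map_app.
    rewrite (flat_map_nil h (repeat KX m)) by (intros x Hx; now apply repeat_spec in Hx as ->).
    rewrite app_nil_r. clear. induction w as [|b w IH]; cbn; auto. f_equal; exact IH.
Qed.

Lemma ruler_passes_out c w m :
  stage_out (ruler_passes c) (map KBit w ++ repeat KX m) = ruler w (m + c).
Proof.
  unfold stage_out, ruler; cbn [ruler_passes flat_map pass_out].
  rewrite !flat_map_at_pos, !flat_map_app, bits_of_bits, bits_of_blanks, !blanks_as_bits,
    !blanks_as_blanks, !app_nil_r, (repeat_app KM m c).
  replace (S (m + c)) with (m + S c) by lia. rewrite (repeat_app KX m (S c)).
  cbn [app]. now rewrite <- !app_assoc.
Qed.

(** The counter starts at [c], is multiplied [k] times by the input length, and the last stage adds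
    [c]: this is [poly_bound]. *)
Lemma ruler_computable c k : exists F, tape_computable F /\
  forall w, F (map KBit w) = ruler w (poly_bound c k (length w)).
Proof.
  exists (fun rho => stage_out (ruler_passes c)
    (Nat.iter k (stage_out mul_passes) (stage_out (init_passes c) rho))). split.
  - apply (tape_computable_comp _ (stage_out (ruler_passes c))); [|apply stage_computable].
    apply (tape_computable_comp _ (Nat.iter k (stage_out mul_passes))); [apply stage_computable|].
    apply tape_computable_iter, stage_computable.
  - intros w. rewrite init_passes_out.
    assert (E : Nat.iter k (stage_out mul_passes) (map KBit w ++ repeat KX c)
      = map KBit w ++ repeat KX (c * length w ^ k)).
    { induction k as [|k IH]; cbn [Nat.iter nat_rect].
      - f_equal; f_equal; cbn; lia.
      - fold (Nat.iter k (stage_out mul_passes) (map KBit w ++ repeat KX c)).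
        rewrite IH, mul_passes_out. f_equal; f_equal. cbn; lia. }
    now rewrite E, ruler_passes_out.
Qed.

(** * Tilings and runs *)

(* Wang tiles whose horizontal seams are the successive rows of the tableau. In
   [TEnter d q a] the head arrives in state [q], moving right iff [d]; [TStart]
   sends the head from the column [KL] of the input row to its first cell. *)
Inductive tile :=
| TPlain (a : nat)
| TEnter (d : bool) (q a : nat)
| TStep (q a q' b : nat) (m : move)
| THalt (a : nat)
| TStart.

Lemma tile_eq_dec (x y : tile) : {x = y} + {x <> y}.
Proof. repeat decide equality. Defined.

Lemma option_pair_eq_dec (x y : option (bool * nat)) : {x = y} + {x <> y}.
Proof. repeat decide equality. Defined.

Lemma seam_eq_dec (x y : option nat * nat) : {x = y} + {x <> y}.
Proof. repeat decide equality. Defined.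

Definition letter (k : kind) : nat := match k with KBit b => bit_sym b | _ => 0 end.
Definition is_row (k : kind) : bool := match k with KZ | KM | KL => true | _ => false end.

(** Configurations have no absolute coordinates; [p] places the head in a column of the tableau. *)
Definition cell_at (p : nat) (l r : list nat) (i : nat) : nat :=
  if i <? p then nth (p - 1 - i) l 0 else nth (i - p) r 0.

Definition view (p q : nat) (l r : list nat) (i : nat) : option nat * nat :=
  (if i =? p then Some q else None, cell_at p l r i).

Definition moved (p : nat) (m : move) : nat :=
  match m with MLeft => p - 1 | MRight => S p | MStay => p end.

(** [0 < p] makes the truncated [p - 1] exact; the default 0 beyond the lists is the blank, as in
    [apply_move]. *)
Lemma cell_at_move p l r b m l' r' i :
  0 < p -> (l', r') = apply_move l r b m ->
  cell_at (moved p m) l' r' i = if i =? p then b else cell_at p l r i.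
Proof.
  intros Hp E. unfold cell_at. destruct m; cbn in E; inversion E; subst; clear E; cbn [moved].
  - destruct (Nat.eqb_spec i p), (Nat.ltb_spec i (p - 1)), (Nat.ltb_spec i p); subst; try lia.
    + now replace (p - (p - 1)) with 1 by lia.
    + rewrite nth_tl. f_equal; lia.
    + replace (i - (p - 1)) with 0 by lia. replace (p - 1 - i) with 0 by lia. cbn.
      now rewrite hd_nth.
    + replace (i - (p - 1)) with (S (S (i - p - 1))) by lia. cbn. rewrite nth_tl. f_equal; lia.
  - destruct (Nat.eqb_spec i p), (Nat.ltb_spec i (S p)), (Nat.ltb_spec i p); subst; try lia.
    + now replace (S p - 1 - p) with 0 by lia.
    + now replace (S p - 1 - i) with (S (p - 1 - i)) by lia.
    + rewrite nth_tl. f_equal; lia.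
  - destruct (Nat.eqb_spec i p), (Nat.ltb_spec i p); subst; try lia.
    + now rewrite Nat.sub_diag.
    + now replace (i - p) with (S (i - p - 1)) by lia; cbn; rewrite nth_tl.
Qed.

Lemma cell_at_head p l r : cell_at p l r p = hd 0 r.
Proof. unfold cell_at. now rewrite Nat.ltb_irrefl, Nat.sub_diag, hd_nth. Qed.

Lemma steps_snoc M n c c' c'' : steps M n c c' -> step M c' c'' -> steps M (S n) c c''.
Proof.
  revert c; induction n as [|n IH]; cbn; intros c H H'.
  - subst; eauto.
  - destruct H as (c1 & H1 & H2). exists c1; split; auto. now apply IH.
Qed.

Section Tableau.

Variable M : TM.

Definition north (x : tile) : option nat * nat :=
  match x with
  | TPlain a | TEnter _ _ a => (None, a)
  | TStep q a _ _ _ => (Some q, a)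
  | THalt a => (Some (tm_final M), a)
  | TStart => (None, 0)
  end.

(** The state leaves a [TStep] downwards only for [MStay]; otherwise it crosses a vertical edge into
    a neighbouring [TEnter]. [THalt] passes the final state on, so that short runs fill all rows. *)
Definition south (x : tile) : option nat * nat :=
  match x with
  | TPlain a => (None, a)
  | TEnter _ q a => (Some q, a)
  | TStep _ _ q' b MStay => (Some q', b)
  | TStep _ _ _ b _ => (None, b)
  | THalt a => (Some (tm_final M), a)
  | TStart => (None, 0)
  end.

Definition east (x : tile) : option (bool * nat) :=
  match x with
  | TStep _ _ q' _ MRight => Some (true, q')
  | TEnter false q _ => Some (false, q)
  | TStart => Some (true, tm_start M)
  | _ => None
  end.

Definition west (x : tile) : option (bool * nat) :=
  match x with
  | TStep _ _ q' _ MLeft => Some (false, q')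
  | TEnter true q _ => Some (true, q)
  | _ => None
  end.

Definition letters : list nat :=
  [0; 1; 2] ++ map (fun '(_, _, _, b, _) => b) (tm_trans M).

Definition targets : list nat :=
  tm_start M :: map (fun '(_, _, q', _, _) => q') (tm_trans M).

Definition tiles : list tile :=
  TStart :: map TPlain letters ++ map THalt letters ++
  flat_map (fun q => map (TEnter true q) letters ++ map (TEnter false q) letters) targets ++
  map (fun '(q, a, q', b, m) => TStep q a q' b m) (tm_trans M).

Definition tile_ok (row col : kind) (x : tile) : bool :=
  match col with
  | KZ | KE => match x with TPlain 0 => true | _ => false end
  | _ =>
    match row with
    | KZ =>
      match col, x with
      | KL, TStart => true
      | KL, _ => false
      | _, TPlain a | _, TEnter true _ a => a =? letter col
      | _, _ => false
      end
    | KM => match x with TStart => false | _ => true end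
    | KL => match x with TPlain _ | THalt _ => true | _ => false end
    | _ => false
    end
  end.

Lemma in_tiles x : In x tiles <->
  match x with
  | TPlain a | THalt a => In a letters
  | TEnter _ q a => In q targets /\ In a letters
  | TStep q a q' b m => In (q, a, q', b, m) (tm_trans M)
  | TStart => True
  end.
Proof.
  unfold tiles. cbn [In]. rewrite !in_app_iff, !in_map_iff, in_flat_map. split.
  - intros [<-|[(a & <- & H)|[(a & <- & H)|[(q & Hq & H)|([[[[q a] q'] b] m] & <- & H)]]]]; auto.
    apply in_app_or in H as [H|H]; apply in_map_iff in H as (a & <- & H); auto.
  - destruct x as [a|d q a|q a q' b m|a|]; intros H; auto.
    + right; left; eauto.
    + right; right; right; left. exists q; split; [apply H|]. apply in_or_app.
      destruct d; [left|right]; now apply in_map.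
    + right; right; right; right. now exists (q, a, q', b, m).
    + right; right; left; eauto.
Qed.

(** * From a tableau to a run: one row is one step *)

Section Row.

Variables (N : nat) (row : nat -> tile) (p q : nat) (l r : list nat).
Hypothesis Hp : p < N.
Hypothesis Hin : forall i, i < N -> In (row i) tiles /\ row i <> TStart.
Hypothesis Hfirst : row 0 = TPlain 0.
Hypothesis Hlast : row (N - 1) = TPlain 0.
Hypothesis Hseam : forall i, S i < N -> east (row i) = west (row (S i)).
Hypothesis Hview : forall i, i < N -> north (row i) = view p q l r i.

(** The direction flag keeps two [TEnter] tiles from matching each other and creating heads out of
    nothing. Without [TStart] the partner of a [TEnter] is a [TStep], whose north edge shows the
    head and thus sits in column [p]; the walls exclude partners beyond the ends. *)
Lemma row_off_head i : i < N -> i <> p ->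
  row i = TPlain (cell_at p l r i) \/
  (i = S p /\ exists q0 a q' b,
     row p = TStep q0 a q' b MRight /\ row i = TEnter true q' (cell_at p l r i)) \/
  (S i = p /\ exists q0 a q' b,
     row p = TStep q0 a q' b MLeft /\ row i = TEnter false q' (cell_at p l r i)).
Proof.
  intros Hi Hne. pose proof (Hview i Hi) as V. unfold view in V.
  destruct (Nat.eqb_spec i p); [contradiction|].
  pose proof (Hin i Hi) as [_ HS].
  destruct (row i) as [a|[] q' a|q0 a q' b m|a|] eqn:E; cbn in V; inversion V; subst; auto;
    try congruence.
  - right; left. destruct i as [|i]; [congruence|].
    specialize (Hseam i Hi). rewrite E in Hseam; cbn in Hseam.
    destruct (row i) as [|[]|q0 a q1 b []| |] eqn:E'; cbn in Hseam; try discriminate.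
    + pose proof (Hview i ltac:(lia)) as V'. rewrite E' in V'. unfold view in V'.
      destruct (Nat.eqb_spec i p) as [->|]; [|discriminate]. inversion Hseam; subst.
      split; auto. do 4 eexists; split; eauto.
    + exfalso. now apply (proj2 (Hin i ltac:(lia))).
  - right; right. destruct (Nat.eq_dec i (N - 1)) as [->|]; [congruence|].
    assert (Hi' : S i < N) by lia.
    specialize (Hseam i Hi'). rewrite E in Hseam; cbn in Hseam.
    destruct (row (S i)) as [|[]|q0 a q1 b []| |] eqn:E'; cbn in Hseam; try discriminate.
    pose proof (Hview (S i) Hi') as V'. rewrite E' in V'. unfold view in V'.
    destruct (Nat.eqb_spec (S i) p) as [<-|]; [|discriminate]. inversion Hseam; subst.
    split; auto. do 4 eexists; split; eauto.
Qed.

(** The head is neither lost nor duplicated: a moving [TStep] forces a [TEnter] beside it, and no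
    [TEnter] stands elsewhere. *)
Lemma row_step :
  (q = tm_final M /\ forall i, i < N -> south (row i) = view p q l r i) \/
  (exists q' l' r' p', step M (q, l, r) (q', l', r') /\ p' < N /\
     forall i, i < N -> south (row i) = view p' q' l' r' i).
Proof.
  pose proof (Hview p Hp) as V. unfold view in V. rewrite Nat.eqb_refl, cell_at_head in V.
  assert (Hp0 : 0 < p) by (destruct p; [rewrite Hfirst in V; discriminate|lia]).
  assert (HpN : p <> N - 1) by (intros ->; rewrite Hlast in V; discriminate).
  destruct (row p) as [a|d q0 a|q0 a q' b m|a|] eqn:E; cbn in V; try discriminate V.
  - injection V as -> ->. right.
    exists q', (fst (apply_move l r b m)), (snd (apply_move l r b m)), (moved p m).
    split; [|split; [destruct m; cbn; lia|]].
    + exists b, m. split; [|now destruct (apply_move l r b m)].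
      pose proof (proj1 (Hin p Hp)) as H. rewrite E, in_tiles in H. exact H.
    + intros i Hi. unfold view. rewrite cell_at_move with (b := b) (m := m) (l := l) (r := r);
        [|auto|now destruct (apply_move l r b m)].
      destruct (Nat.eqb_spec i p) as [->|Hne].
      * rewrite E. destruct m; cbn; [destruct (Nat.eqb_spec p (p - 1)); auto; lia| |].
        -- destruct (Nat.eqb_spec p (S p)); auto; lia.
        -- now rewrite Nat.eqb_refl.
      * destruct (row_off_head i Hi Hne) as [Ei|[(-> & q1 & a & q2 & b' & E1 & Ei)
          |(Hs & q1 & a & q2 & b' & E1 & Ei)]]; rewrite Ei; cbn [south].
        (* A [TPlain] in the column the head moves to would leave the edge signal of the [TStep]
           unmatched. *)
        -- destruct (Nat.eqb_spec i (moved p m)) as [Hm|]; auto. exfalso.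
           destruct m; cbn in Hm; [| |contradiction].
           ++ specialize (Hseam i ltac:(lia)). replace (S i) with p in Hseam by lia.
              rewrite E, Ei in Hseam. discriminate.
           ++ subst i. specialize (Hseam p Hi). rewrite E, Ei in Hseam. discriminate.
        -- rewrite E in E1; inversion E1; subst. cbn [moved]. now rewrite Nat.eqb_refl.
        -- rewrite E in E1; inversion E1; subst. cbn [moved].
           now replace (S i - 1) with i by lia; rewrite Nat.eqb_refl.
  - injection V as Vq ->. left; split; auto. intros i Hi. destruct (Nat.eq_dec i p) as [->|Hne].
    + rewrite E. unfold view. now rewrite Nat.eqb_refl, cell_at_head, <- Vq.
    + destruct (row_off_head i Hi Hne) as [Ei|[(_ & q1 & a & q2 & b' & E1 & _)
          |(_ & q1 & a & q2 & b' & E1 & _)]]; try congruence.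
      rewrite Ei. unfold view. destruct (Nat.eqb_spec i p); auto; contradiction.
Qed.

End Row.

Definition is_wall (k : kind) : Prop := k = KZ \/ k = KE.

Definition tableau (rho : list kind) (th : nat -> nat -> tile) : Prop :=
  forall t i, t < length rho -> i < length rho -> is_row (at_pos rho t) = true ->
    In (th t i) tiles /\ tile_ok (at_pos rho t) (at_pos rho i) (th t i) = true /\
    (S i < length rho -> east (th t i) = west (th t (S i))) /\
    (S t < length rho -> is_row (at_pos rho (S t)) = true -> south (th t i) = north (th (S t) i)).

Definition nth_tile (x : nat) : tile := nth x tiles TStart.

Definition ok (row col : kind) (x : nat) : bool := tile_ok row col (nth_tile x).

Definition hc (x y : nat) : bool :=
  if option_pair_eq_dec (east (nth_tile x)) (west (nth_tile y)) then true else false.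

Definition vc (x y : nat) : bool :=
  if seam_eq_dec (south (nth_tile x)) (north (nth_tile y)) then true else false.

Fixpoint tile_index (x : tile) (xs : list tile) : nat :=
  match xs with
  | [] => 0
  | y :: ys => if tile_eq_dec x y then 0 else S (tile_index x ys)
  end.

Lemma tile_index_spec x xs : In x xs ->
  tile_index x xs < length xs /\ nth (tile_index x xs) xs TStart = x.
Proof.
  induction xs as [|y ys IH]; cbn; [easy|]. intros H.
  destruct (tile_eq_dec x y); [split; [lia|auto]|].
  destruct H as [->|H]; [contradiction|]. split; [|now apply IH].
  apply IH in H; lia.
Qed.

Lemma tiling_tableau rho :
  (exists th, tiling (length tiles) is_row ok hc vc rho th) <-> (exists th, tableau rho th).
Proof.
  split; intros [th H].
  - exists (fun t i => nth_tile (th t i)). intros t i Ht Hi R.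
    destruct (H t i Ht Hi R) as (H1 & H2 & H3 & H4). split; [|split; [|split]]; auto.
    + now apply nth_In.
    + intros Hi'. specialize (H3 Hi'). unfold hc in H3.
      destruct (option_pair_eq_dec _ _); easy.
    + intros Ht' R'. specialize (H4 Ht' R'). unfold vc in H4. destruct (seam_eq_dec _ _); easy.
  - exists (fun t i => tile_index (th t i) tiles). intros t i Ht Hi R.
    destruct (H t i Ht Hi R) as (H1 & H2 & H3 & H4).
    destruct (tile_index_spec _ _ H1) as [L E]. split; [|split; [|split]]; auto.
    + unfold ok, nth_tile. now rewrite E.
    + intros Hi'. specialize (H3 Hi'). unfold hc, nth_tile. rewrite E.
      destruct (H t (S i) Ht Hi' R) as (H1' & _). rewrite (proj2 (tile_index_spec _ _ H1')).
      destruct (option_pair_eq_dec _ _); easy.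
    + intros Ht' R'. specialize (H4 Ht' R'). unfold vc, nth_tile. rewrite E.
      destruct (H (S t) i Ht' Hi R') as (H1' & _). rewrite (proj2 (tile_index_spec _ _ H1')).
      destruct (seam_eq_dec _ _); easy.
Qed.

(** * The ruler as rows and columns of the tableau *)

Variables (w : list bool) (T : nat).

Let rho := ruler w T.
Let N := length rho.
(** The head starts right after [KL], with at least [T] columns that are no walls on either side, so
    [T] steps never reach a wall. *)
Let start := T + 2.

Lemma ruler_length : N = 2 * T + length w + 4.
Proof.
  unfold N, rho, ruler. cbn [length]. rewrite length_app; cbn [length].
  rewrite !length_app, !repeat_length, length_map. cbn [length]. lia.
Qed.

Lemma ruler_mark j : 1 <= j <= T -> at_pos rho j = KM.
Proof.
  intros H. unfold at_pos, rho, ruler. destruct j as [|j]; [lia|]. cbn [nth].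
  rewrite app_nth1 by (rewrite repeat_length; lia). apply nth_repeat_lt; lia.
Qed.

Lemma ruler_after j : S T <= j ->
  at_pos rho j = nth (j - S T) (KL :: map KBit w ++ repeat KX (S T) ++ [KE]) KX.
Proof.
  intros H. unfold at_pos, rho, ruler. destruct j as [|j]; [lia|]. cbn [nth].
  rewrite app_nth2 by (rewrite repeat_length; lia). now rewrite repeat_length.
Qed.

Lemma ruler_last_row : at_pos rho (S T) = KL.
Proof. rewrite ruler_after by lia. now rewrite Nat.sub_diag. Qed.

Lemma ruler_input j : start <= j -> j < N - 1 ->
  at_pos rho j = nth (j - start) (map KBit w) KX.
Proof.
  unfold start; intros H H'. rewrite ruler_length in H'. rewrite ruler_after by lia.
  replace (j - S T) with (S (j - (T + 2))) by lia. cbn [nth].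
  destruct (Nat.lt_ge_cases (j - (T + 2)) (length w)) as [L|L].
  - rewrite app_nth1 by now rewrite length_map. auto.
  - rewrite app_nth2 by now rewrite length_map. rewrite length_map.
    rewrite app_nth1 by (rewrite repeat_length; lia). rewrite nth_repeat.
    rewrite nth_overflow; auto. now rewrite length_map.
Qed.

Lemma ruler_end : at_pos rho (N - 1) = KE.
Proof.
  pose proof ruler_length. rewrite ruler_after by lia.
  replace (N - 1 - S T) with (S (length w + (S T))) by lia. cbn [nth].
  rewrite app_nth2; rewrite length_map; [|lia].
  rewrite app_nth2; rewrite repeat_length; [|lia].
  now replace (_ - _ - _) with 0 by lia.
Qed.

Lemma ruler_cases j : j < N ->
  j = 0 /\ at_pos rho j = KZ \/ 1 <= j <= T /\ at_pos rho j = KM \/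
  j = S T /\ at_pos rho j = KL \/ j = N - 1 /\ at_pos rho j = KE \/
  start <= j < N - 1 /\ (at_pos rho j = KX \/ exists b, at_pos rho j = KBit b).
Proof.
  intros Hj. destruct (Nat.eq_dec j 0) as [->|]; [now left|].
  destruct (Nat.le_gt_cases j T); [right; left; split; [lia|apply ruler_mark; lia]|].
  destruct (Nat.eq_dec j (S T)) as [->|]; [do 2 right; left; split; auto; apply ruler_last_row|].
  destruct (Nat.eq_dec j (N - 1)) as [->|]; [do 3 right; left; split; auto; apply ruler_end|].
  do 4 right. unfold start. split; [lia|]. rewrite ruler_input by (unfold start; lia).
  destruct (nth_in_or_default (j - start) (map KBit w) KX) as [I|I]; [right|now left].
  apply in_map_iff in I as (b & <- & _); eauto.
Qed.

Lemma ruler_is_row j : j < N -> (is_row (at_pos rho j) = true <-> j <= S T).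
Proof.
  intros Hj. pose proof ruler_length.
  destruct (ruler_cases j Hj) as [[-> ->]|[[L ->]|[[-> ->]|[[-> ->]|[L [->|[b ->]]]]]]];
    cbn [is_row]; unfold start in *; split; intros; try discriminate; auto; lia.
Qed.

Lemma ruler_wall j : j < N -> (is_wall (at_pos rho j) <-> j = 0 \/ j = N - 1).
Proof.
  intros Hj. pose proof ruler_length. unfold is_wall.
  destruct (ruler_cases j Hj) as [[-> ->]|[[L ->]|[[-> ->]|[[-> ->]|[L [->|[b ->]]]]]]];
    unfold start in *; intuition (try congruence; try lia).
Qed.

(** The columns before [start] and those past the input stand for blank tape, so all kinds other
    than bits have letter 0. *)
Lemma ruler_letter j : j < N ->
  letter (at_pos rho j) = cell_at start [] (map bit_sym w) j.
Proof.
  intros Hj. pose proof ruler_length. unfold cell_at, start.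
  destruct (Nat.ltb_spec j (T + 2)).
  - destruct (ruler_cases j Hj) as [[-> ->]|[[L ->]|[[-> ->]|[[-> ->]|[L _]]]]];
      try (rewrite nth_overflow; [reflexivity|cbn [length]; lia]). unfold start in L; lia.
  - destruct (Nat.eq_dec j (N - 1)) as [->|].
    + rewrite ruler_end. rewrite nth_overflow; auto. rewrite length_map; lia.
    + rewrite ruler_input by (unfold start; lia). unfold start.
      rewrite <- (map_nth letter), map_map. reflexivity.
Qed.

Lemma wall_tile row col x : is_wall col -> tile_ok row col x = true -> x = TPlain 0.
Proof. intros [->| ->]; cbn; destruct x as [[]| | | |]; easy. Qed.

(** [TStart], forced in column [KL], is the only tile of the input row that emits to the east, so
    the head enters just after it and nowhere else. *)
Lemma first_row th i : tableau rho th -> i < N ->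
  south (th 0 i) = view start (tm_start M) [] (map bit_sym w) i.
Proof.
  intros Hth Hi. pose proof ruler_length as HN.
  assert (G : forall j, j < N -> tile_ok KZ (at_pos rho j) (th 0 j) = true /\
    (S j < N -> east (th 0 j) = west (th 0 (S j)))).
  { intros j Hj.
    destruct (Hth 0 j ltac:(unfold N in *; lia) Hj eq_refl) as (_ & H1 & H2 & _); auto. }
  assert (TL : th 0 (S T) = TStart).
  { destruct (G (S T) ltac:(lia)) as [H _]. rewrite ruler_last_row in H. cbn in H.
    destruct (th 0 (S T)); easy. }
  assert (P : forall j, j < N -> j <> S T ->
    th 0 j = TPlain (letter (at_pos rho j)) \/
    exists q, th 0 j = TEnter true q (letter (at_pos rho j))).
  { intros j Hj Hne. destruct (G j Hj) as [H _].
    destruct (ruler_cases j Hj) as [[_ E]|[[_ E]|[[L E]|[[_ E]|[_ [E|[b E]]]]]]]; try easy;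
      rewrite E in *; cbn in H; destruct (th 0 j) as [[|a]|[] q a| | |]; try discriminate;
      try (apply Nat.eqb_eq in H; rewrite H); eauto. }
  unfold view. rewrite <- ruler_letter by auto.
  destruct (Nat.eqb_spec i start) as [->|Hs].
  - destruct (P start Hi) as [E|[q E]]; [unfold start; lia| |];
      destruct (G (S T) ltac:(lia)) as [_ H]; specialize (H ltac:(lia));
      replace (S (S T)) with start in H by (unfold start; lia); rewrite TL, E in H; cbn in H;
      [discriminate|]. inversion H; subst. now rewrite E.
  - destruct (Nat.eq_dec i (S T)) as [->|Hne].
    + now rewrite TL, ruler_last_row.
    + destruct (P i Hi Hne) as [E|[q E]]; [now rewrite E|exfalso].
      destruct i as [|i].
      * destruct (G 0 Hi) as [H _]. apply wall_tile in H; [congruence|now left].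
      * destruct (G i ltac:(lia)) as [_ H]. specialize (H Hi). rewrite E in H; cbn in H.
        destruct (P i ltac:(lia)) as [E'|[q' E']]; [unfold start in *; lia| |];
          rewrite E' in H; discriminate.
Qed.

(** A halted configuration may be repeated from row to row, so the run can be shorter than the
    number of rows: hence [n <= k] in the induction. *)
Lemma tableau_accepts th : tableau rho th ->
  exists n l r, n <= T /\ steps M n (init_config M w) (tm_final M, l, r).
Proof.
  intros Hth. pose proof ruler_length as HN.
  assert (V : forall t i, t <= T -> i < N -> south (th t i) = north (th (S t) i)).
  { intros t i Ht Hi. apply (Hth t i); unfold N in *; try lia; auto;
      apply ruler_is_row; unfold N; lia. }
  assert (R : forall k, k <= T -> exists n q l r p, n <= k /\
    steps M n (init_config M w) (q, l, r) /\ p < N /\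
    forall i, i < N -> north (th (S k) i) = view p q l r i).
  { induction k as [|k IH]; intros Hk.
    - exists 0, (tm_start M), [], (map bit_sym w), start. split; [lia|]. split; [reflexivity|].
      split; [unfold start; lia|]. intros i Hi. rewrite <- V by (auto; lia). now apply first_row.
    - destruct IH as (n & q & l & r & p & Hn & Hs & Hp & Hv); [lia|].
      assert (G : forall i, i < N -> In (th (S k) i) tiles /\
        tile_ok KM (at_pos rho i) (th (S k) i) = true /\
        (S i < N -> east (th (S k) i) = west (th (S k) (S i)))).
      { intros i Hi. rewrite <- (ruler_mark (S k)) by lia.
        destruct (Hth (S k) i) as (H1 & H2 & H3 & _); unfold N in *; auto; try lia.
        apply ruler_is_row; unfold N; lia. }
      assert (W : forall i, i < N -> is_wall (at_pos rho i) -> th (S k) i = TPlain 0).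
      { intros i Hi Hw. eapply wall_tile; eauto. now apply G. }
      destruct (row_step N (th (S k)) p q l r) as [[-> H]|(q' & l' & r' & p' & H1 & H2 & H3)]; auto.
      + intros i Hi. split; [now apply G|]. intros E. destruct (G i Hi) as (_ & H & _).
        rewrite E in H. now destruct (at_pos rho i).
      + apply W; [lia|now left].
      + apply W; [lia|right; apply ruler_end].
      + intros i Hi. apply G; lia.
      + exists n, (tm_final M), l, r, p. repeat split; auto. intros i Hi.
        rewrite <- V by (auto; lia). auto.
      + exists (S n), q', l', r', p'. repeat split; auto; [lia|eapply steps_snoc; eauto|].
        intros i Hi. rewrite <- V by (auto; lia). auto. }
  destruct (R T) as (n & q & l & r & p & Hn & Hs & Hp & Hv); auto.
  exists n, l, r; split; auto. specialize (Hv p Hp). unfold view in Hv. rewrite Nat.eqb_refl in Hv.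
  destruct (Hth (S T) p) as (_ & H & _); unfold N in *; auto; try lia.
  { apply ruler_is_row; unfold N; lia. }
  rewrite ruler_last_row in H.
  (* In the acceptance row only [THalt] shows a head on its north edge, so [q] is the final
     state. *)
  destruct (th (S T) p) as [a|d q' a|q' a q1 b m|a|]; cbn in Hv; try discriminate.
  - destruct (at_pos rho p); discriminate.
  - injection Hv as -> _. exact Hs.
Qed.

(** * From a run to a tableau *)

Definition row_good (k : kind) (row : nat -> tile) : Prop :=
  forall i, i < N -> In (row i) tiles /\ tile_ok k (at_pos rho i) (row i) = true /\
    (S i < N -> east (row i) = west (row (S i))).

(* Invariant as long as the head, in column [p], stays off the walls. *)
Definition tape_good (p : nat) (l r : list nat) : Prop :=
  cell_at p l r 0 = 0 /\ cell_at p l r (N - 1) = 0 /\ forall i, In (cell_at p l r i) letters.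

Lemma not_wall i : 0 < i -> i < N - 1 -> ~ is_wall (at_pos rho i).
Proof. intros H H'. rewrite ruler_wall by lia. lia. Qed.

Lemma tile_ok_mark col x : x <> TStart -> (is_wall col -> x = TPlain 0) -> tile_ok KM col x = true.
Proof.
  intros H W. destruct col; cbn; try (rewrite W by (now (left + right)); reflexivity);
    destruct x; easy.
Qed.

Lemma tile_ok_last col x : (exists a, x = TPlain a \/ x = THalt a) ->
  (is_wall col -> x = TPlain 0) -> tile_ok KL col x = true.
Proof.
  intros (a & [-> | ->]) W; destruct col; try reflexivity;
    (rewrite W by (now (left + right)); reflexivity).
Qed.

Definition plain_row (p : nat) (l r : list nat) (i : nat) : tile := TPlain (cell_at p l r i).

Lemma plain_wall p l r i : tape_good p l r -> i < N -> is_wall (at_pos rho i) ->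
  plain_row p l r i = TPlain 0.
Proof.
  intros (H0 & H1 & _) Hi H. apply ruler_wall in H as [->| ->]; auto; unfold plain_row; congruence.
Qed.

Definition halt_row (p : nat) (l r : list nat) (i : nat) : tile :=
  if i =? p then THalt (cell_at p l r i) else plain_row p l r i.

Lemma halt_row_good k p l r : k = KM \/ k = KL -> 0 < p -> p < N - 1 -> tape_good p l r ->
  row_good k (halt_row p l r).
Proof.
  intros Hk Hp Hp' Hg i Hi. unfold halt_row. repeat split.
  - apply in_tiles. destruct (i =? p); apply Hg.
  - assert (W : is_wall (at_pos rho i) ->
      (if i =? p then THalt (cell_at p l r i) else plain_row p l r i) = TPlain 0).
    { intros H. destruct (Nat.eqb_spec i p) as [->|]; [|now apply plain_wall].
      now apply not_wall in H. }
    destruct Hk as [-> | ->].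
    + apply tile_ok_mark; auto. now destruct (i =? p).
    + apply tile_ok_last; auto. destruct (i =? p); unfold plain_row; eauto.
  - intros _. now destruct (i =? p), (S i =? p).
Qed.

Lemma halt_row_seams p l r i :
  north (halt_row p l r i) = view p (tm_final M) l r i /\
  south (halt_row p l r i) = view p (tm_final M) l r i.
Proof. unfold halt_row, view. now destruct (i =? p). Qed.

Definition step_row (p q q' b : nat) (m : move) (l r : list nat) (i : nat) : tile :=
  if i =? p then TStep q (cell_at p l r i) q' b m
  else if i =? moved p m then
    TEnter (match m with MRight => true | _ => false end) q' (cell_at p l r i)
  else plain_row p l r i.

Lemma in_letters q a q' b m : In (q, a, q', b, m) (tm_trans M) -> In b letters /\ In q' targets.
Proof.
  intros H. split; [apply in_or_app|]; right;
    [now apply (in_map (fun '(_, _, _, b, _) => b)) in H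
    |now apply (in_map (fun '(_, _, q', _, _) => q')) in H].
Qed.

Lemma step_row_good p q q' b m l r : In (q, hd 0 r, q', b, m) (tm_trans M) ->
  1 < p -> p + 1 < N - 1 -> tape_good p l r -> row_good KM (step_row p q q' b m l r).
Proof.
  intros Ht Hp Hp' Hg i Hi. unfold step_row. repeat split.
  - apply in_tiles. destruct (Nat.eqb_spec i p) as [->|].
    + now rewrite cell_at_head.
    + destruct (i =? moved p m); [split; [|apply Hg]|apply Hg].
      eapply in_letters; eauto.
  - apply tile_ok_mark.
    + now destruct (i =? p), (i =? moved p m).
    + intros H. destruct (Nat.eqb_spec i p) as [->|]; [apply not_wall in H; easy || lia|].
      destruct (Nat.eqb_spec i (moved p m)) as [->|]; [|now apply plain_wall].
      apply not_wall in H; destruct m; cbn [moved] in *; easy || lia.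
  - intros _. destruct m; cbn [moved];
      repeat match goal with |- context [?x =? ?y] => destruct (Nat.eqb_spec x y) end;
      subst; try lia; reflexivity.
Qed.

Lemma step_row_seams p q q' b m l r l' r' i :
  0 < p -> (l', r') = apply_move l r b m ->
  north (step_row p q q' b m l r i) = view p q l r i /\
  south (step_row p q q' b m l r i) = view (moved p m) q' l' r' i.
Proof.
  intros Hp E. unfold view. rewrite (cell_at_move _ _ _ _ _ _ _ i Hp E). unfold step_row.
  destruct (Nat.eqb_spec i p) as [->|Hne].
  - split; auto. destruct (Nat.eqb_spec p (moved p m)) as [H|H];
      destruct m; cbn [moved south] in *; auto; lia.
  - now destruct (i =? moved p m).
Qed.

Lemma tape_good_step q a q' p l r b m l' r' : In (q, a, q', b, m) (tm_trans M) ->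
  0 < p -> p < N - 1 -> tape_good p l r -> (l', r') = apply_move l r b m ->
  tape_good (moved p m) l' r'.
Proof.
  intros Ht Hp Hp' (H0 & H1 & H2) E. unfold tape_good.
  rewrite !(cell_at_move _ _ _ _ _ _ _ _ Hp E).
  destruct (Nat.eqb_spec 0 p), (Nat.eqb_spec (N - 1) p); try lia. repeat split; auto.
  intros i. rewrite (cell_at_move _ _ _ _ _ _ _ _ Hp E).
  destruct (i =? p); auto. eapply in_letters; eauto.
Qed.

(** [k] counts the rows left before the acceptance row. The distance to either wall drops by at most
    one per row, so both bounds on [p] survive the induction. *)
Lemma rows_of_run k : forall n q p l r lf rf, n <= k ->
  steps M n (q, l, r) (tm_final M, lf, rf) -> k < p -> p + k < N - 1 -> tape_good p l r ->
  exists th, (forall i, north (th 0 i) = view p q l r i) /\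
    (forall t, t <= k -> row_good (if t =? k then KL else KM) (th t)) /\
    (forall t i, t < k -> south (th t i) = north (th (S t) i)).
Proof.
  induction k as [|k IH]; intros n q p l r lf rf Hn Hs Hp Hp' Hg.
  - replace n with 0 in Hs by lia. injection Hs as -> _ _.
    exists (fun _ => halt_row p l r). split; [|split].
    + intros i; apply halt_row_seams.
    + intros t Ht. replace t with 0 by lia. apply halt_row_good; auto; lia.
    + lia.
  - assert (C : exists n' q' p' l' r' row, n' <= k /\
      steps M n' (q', l', r') (tm_final M, lf, rf) /\ k < p' /\ p' + k < N - 1 /\
      tape_good p' l' r' /\ row_good KM row /\
      forall i, north (row i) = view p q l r i /\ south (row i) = view p' q' l' r' i).
    { destruct n as [|n].
      (* A finished run is padded by a row that keeps the halted head in place. *)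
      - pose proof Hs as Hs'. injection Hs' as -> _ _.
        exists 0, (tm_final M), p, l, r, (halt_row p l r).
        split; [lia|]. split; [exact Hs|]. split; [lia|]. split; [lia|]. split; [auto|].
        split; [apply halt_row_good; auto; lia|apply halt_row_seams].
      - destruct Hs as ([[q' l'] r'] & (b & m & Ht & E) & Hs).
        exists n, q', (moved p m), l', r', (step_row p q q' b m l r).
        split; [lia|]. split; [exact Hs|].
        split; [destruct m; cbn [moved]; lia|]. split; [destruct m; cbn [moved]; lia|].
        split; [eapply tape_good_step; eauto; lia|].
        split; [apply step_row_good; auto; lia|]. intros i; apply step_row_seams; auto; lia. }
    destruct C as (n' & q' & p' & l' & r' & row & Hn' & Hs' & H1 & H2 & H3 & H4 & H5).
    destruct (IH n' q' p' l' r' lf rf) as (th & A & B & D); auto.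
    exists (fun t => match t with 0 => row | S t => th t end). split; [|split].
    + intros i; apply H5.
    + intros [|t] Ht; auto. apply B; lia.
    + intros [|t] i Ht; [rewrite A; apply H5|apply D; lia].
Qed.

Definition start_row (i : nat) : tile :=
  if i =? S T then TStart
  else if i =? start then TEnter true (tm_start M) (letter (at_pos rho i))
  else TPlain (letter (at_pos rho i)).

Lemma letter_in_letters k : In (letter k) letters.
Proof. destruct k as [[]| | | | |]; cbn; auto. Qed.

Lemma start_row_good : row_good KZ start_row.
Proof.
  intros i Hi. pose proof ruler_length as HN. unfold start_row. repeat split.
  - apply in_tiles. destruct (i =? S T); auto.
    destruct (i =? start); [split; [now left|]|]; apply letter_in_letters.
  - destruct (Nat.eqb_spec i (S T)) as [->|H1]; [now rewrite ruler_last_row|].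
    destruct (Nat.eqb_spec i start) as [->|H2];
      destruct (ruler_cases _ Hi) as [[L E]|[[L E]|[[L E]|[[L E]|[L [E|[b E]]]]]]]; rewrite E;
      unfold start in *; try lia; try (cbn; apply Nat.eqb_refl); reflexivity.
  - intros _. unfold start.
    repeat match goal with |- context [?x =? ?y] => destruct (Nat.eqb_spec x y) end;
      subst; try lia; reflexivity.
Qed.

Lemma start_row_south i : i < N ->
  south (start_row i) = view start (tm_start M) [] (map bit_sym w) i.
Proof.
  intros Hi. unfold start_row, view. rewrite <- ruler_letter by auto.
  destruct (Nat.eqb_spec i (S T)) as [->|H1].
  - rewrite ruler_last_row. destruct (Nat.eqb_spec (S T) start); auto. unfold start in *; lia.
  - now destruct (i =? start).
Qed.

Lemma accepts_tableau n l r : n <= T ->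
  steps M n (init_config M w) (tm_final M, l, r) -> exists th, tableau rho th.
Proof.
  intros Hn Hs. pose proof ruler_length as HN.
  destruct (rows_of_run T n (tm_start M) start [] (map bit_sym w) l r) as (th & A & B & D); auto;
    try (unfold start; lia).
  { split; [|split].
    - rewrite <- ruler_letter by lia. reflexivity.
    - rewrite <- ruler_letter by lia. now rewrite ruler_end.
    - intros i. unfold cell_at. destruct (i <? start); [rewrite nth_overflow; cbn [length];
        [now left|lia]|].
      destruct (nth_in_or_default (i - start) (map bit_sym w) 0) as [H|H]; [|rewrite H; now left].
      apply in_map_iff in H as ([] & <- & _); cbn; auto. }
  exists (fun t => match t with 0 => start_row | S t => th t end).
  intros t i Ht Hi R. fold N in Ht, Hi. apply ruler_is_row in R; auto.
  destruct t as [|t].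
  - destruct (start_row_good i Hi) as (H1 & H2 & H3). repeat split; auto.
    intros _ _. now rewrite start_row_south, A.
  - destruct (B t ltac:(lia) i Hi) as (H1 & H2 & H3). split; auto. split; [|split; auto].
    + destruct (Nat.eqb_spec t T) as [->|]; [now rewrite ruler_last_row|].
      now rewrite ruler_mark by lia.
    + intros Ht' R'. apply ruler_is_row in R'; auto. apply D; lia.
Qed.

Lemma tiling_accepts :
  (exists th, tiling (length tiles) is_row ok hc vc rho th) <->
  exists n l r, n <= T /\ steps M n (init_config M w) (tm_final M, l, r).
Proof.
  rewrite tiling_tableau. split.
  - intros [th H]. eapply tableau_accepts; eauto.
  - intros (n & l & r & Hn & Hs). eapply accepts_tableau; eauto.
Qed.

End Tableau.

Theorem theorem3 :
  exists (sg : signature) (S : list dependency),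
    sig_wf sg /\
    Forall (wf_dep sg) S /\
    Forall guarded S /\
    sticky S /\
    coNP_hard (repair_checking sg S).
Proof.
  exists sg, deps. split; [apply sg_wf|]. split; [apply deps_wf|]. split; [apply deps_guarded|].
  split; [apply deps_sticky|].
  intros A (L & (M & c & k & HM) & HA).
  destruct (ruler_computable c k) as (F & HF & EF).
  set (m := length (tiles M)). set (T (w : list bool) := poly_bound c k (length w)).
  (* The tiles depend on [M] and not on [w], so the passes that print the databases are fixed; [sg]
     and [deps] do not even depend on [M]. *)
  set (D := db m is_row (ok M) (hc M) (vc M)). set (D' := subdb m is_row (hc M) (vc M)).
  exists (fun w => enc_pair (D (ruler w (T w))) (D' (ruler w (T w)))). split.
  - eapply poly_time_of_tape_computable.
    + eapply tape_computable_comp; [exact HF|apply (stage_computable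
        (db_passes m is_row (ok M) (hc M) (vc M)))].
    + intros w. cbn beta. now rewrite EF, db_passes_out.
  - intros w. unfold D, D', m. now rewrite repair_checking_db, tiling_accepts, HA, HM.
Qed.
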